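(* Let $n\ge2$ and let $\omega$ be a Poincaré like metric on $M^0=M\setminus\{p_1,\dots,p_k\}$ with $k\ge1$. For any $p>2$ there exists $u\in H^1_\omega(M^0)$ with $u\notin L^p_\omega(M^0)$. (Hence the Sobolev inequality $\|u\|_{L^p_\omega(M^0)}\le C\|u\|_{H^1_\omega(M^0)}$ does not hold for any $p>2$.)
   Context: Setting: $M$ is a compact smooth manifold (without boundary) of dimension $n$, $p_1,\dots,p_k\in M$ are finitely many distinct points, and $M^0=M\setminus\{p_1,\dots,p_k\}$. For each $i$ choose a neighborhood $U_i$ of $p_i$ with $U_i\cap U_j=\emptyset$ for $i\ne j$ and a diffeomorphism $\varphi_i:U_i\to B_1(0)\subset\mathbb{R}^n$ with $\varphi_i(p_i)=0$, where $B_1(0)$ is the unit ball. Poincaré like model metric: on $U_i\setminus\{p_i\}$, in the coordinates $x=\varphi_i(\cdot)\in B_1(0)\setminus\{0\}$, put $ds^2=\frac{ds_0^2}{|x|^2(1-\log|x|)^2}$, where $ds_0^2$ is the Euclidean metric; extend this to a Riemannian metric on $M^0$. A Poincaré like metric $\omega$ is a complete Riemannian metric on $M^0$ quasi-isometric to such a metric, i.e. $c^{-1}ds^2\le\omega\le c\,ds^2$ for some constant $c\ge1$. Notation: $dV_\omega$ is the volume element of $\omega$, $\nabla_\omega$ is the gradient of $\omega$, $\|u\|_{L^p_\omega}=(\int_{M^0}|u|^p\,dV_\omega)^{1/p}$, and $H^1_\omega(M^0)$ is the completion of $C^\infty(M)$ in the norm $\|u\|_{H^1_\omega}=\|\nabla_\omega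 u\|_{L^2_\omega}+\|u\|_{L^2_\omega}$. *)

(* Defs.v *)
From HB Require Import structures.
From mathcomp Require Import all_boot all_order all_algebra.
From mathcomp Require Import all_classical all_reals all_analysis.
Import Order.TTheory GRing.Theory Num.Theory.
Import numFieldNormedType.Exports.

Set Implicit Arguments.
Unset Strict Implicit.
Unset Printing Implicit Defensive.

Local Open Scope classical_set_scope.
Local Open Scope ring_scope.

(* Euclidean norm; the norm `|y| of the library on 'rV is the sup norm. *)
Definition enorm (R : realType) (n : nat) (y : 'rV[R]_n) : R :=
  Num.sqrt (\sum_(i < n) y 0 i ^+ 2).

(* [Ck m V f]: f is of class C^m on the open set V; the values of f outside
   of V are irrelevant. *)
Fixpoint Ck (R : realType) (n m : nat) (V : set 'rV[R]_n)
    (f : 'rV[R]_n -> R) : Prop :=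
  if m is m'.+1 then
    (forall y, V y -> differentiable f y) /\
    (forall i : 'I_n, Ck m' V ('D_(delta_mx 0 i) f))
  else forall y, V y -> {for y, continuous f}.

Definition smooth_on (R : realType) (n : nat) (V : set 'rV[R]_n)
    (f : 'rV[R]_n -> R) : Prop :=
  forall m, Ck m V f.

(* Lebesgue integral over R^n of a nonnegative Borel function, as the iterated
   integral over the coordinates (the product measure of the library is itself
   defined by integrating the measures of the sections). *)
Fixpoint integral_Rn (R : realType) (n : nat) :
    ('rV[R]_n -> \bar R) -> \bar R :=
  match n with
  | 0 => fun f => f 0
  | m.+1 => fun f =>
      (\int[@lebesgue_measure R]_(t in [set: R])
         integral_Rn (fun y : 'rV[R]_m => f (row_mx (t%:M : 'rV[R]_1) y)))%E
  end.

(* A homeomorphism from an open set of M onto an open set of R^n. Both maps are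
   total; only their values on [dom] and on [img] below are meaningful. *)
Record chart (R : realType) (M : topologicalType) (n : nat) := Chart {
  dom : set M;
  coord : M -> 'rV[R]_n;
  icoord : 'rV[R]_n -> M;
  dom_open : open dom;
  img_open : open (coord @` dom);
  coordK : forall x, dom x -> icoord (coord x) = x;
  coord_continuous : forall x, dom x -> {for x, continuous coord};
  icoord_continuous :
    forall y, (coord @` dom) y -> {for y, continuous icoord} }.

Definition img (R : realType) (M : topologicalType) (n : nat)
    (c : chart R M n) (W : set M) : set 'rV[R]_n :=
  coord c @` (dom c `&` W).

Definition smooth_transition (R : realType) (M : topologicalType) (n : nat)
    (c c' : chart R M n) : Prop :=
  forall i : 'I_n,
    smooth_on (img c (dom c')) (fun y => coord c' (icoord c y) 0 i).

(* An n-dimensional smooth structure, given by its maximal atlas. In particular,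
   the diffeomorphisms from an open set of M onto an open set of R^n are exactly
   the charts in the atlas. *)
Record smooth_structure (R : realType) (M : topologicalType) (n : nat) :=
  SmoothStructure {
    atlas : set (chart R M n);
    atlas_cover : forall x, exists c, atlas c /\ dom c x;
    atlas_smooth : forall c c', atlas c -> atlas c' -> smooth_transition c c';
    atlas_maximal : forall c,
      (forall c', atlas c' -> smooth_transition c c' /\ smooth_transition c' c)
      -> atlas c }.

(* Some chart around x, used only for chart-independent quantities. *)
Definition chart_at (R : realType) (M : topologicalType) (n : nat)
    (A : smooth_structure R M n) (x : M) : chart R M n :=
  sval (cid (atlas_cover A x)).

Definition smooth_function (R : realType) (M : topologicalType) (n : nat)
    (A : smooth_structure R M n) (u : M -> R) : Prop :=
  forall c, atlas A c -> smooth_on (img c setT) (u \o icoord c).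

(* [g c x] is the matrix (g_ij) at x in the coordinates of the chart c. *)
Definition tensor2 (R : realType) (M : topologicalType) (n : nat) :=
  chart R M n -> M -> 'M[R]_n.

(* Tangent vectors are row vectors, and [jacobian f y] acts on their right. *)
Definition qform (R : realType) (n : nat) (G : 'M[R]_n) (v : 'rV[R]_n) : R :=
  (v *m G *m v^T) 0 0.

Record riemannian_metric (R : realType) (M : topologicalType) (n : nat)
    (A : smooth_structure R M n) (W : set M) (g : tensor2 R M n) : Prop :=
  RiemannianMetric {
    metric_sym : forall c x, atlas A c -> dom c x -> W x -> (g c x)^T = g c x;
    metric_pos : forall c x v, atlas A c -> dom c x -> W x -> v != 0 ->
      0 < qform (g c x) v;
    metric_smooth : forall c (i j : 'I_n), atlas A c ->
      smooth_on (img c W) (fun y => g c (icoord c y) i j);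
    metric_change : forall c c' x, atlas A c -> atlas A c' ->
      dom c x -> dom c' x -> W x ->
      let J := jacobian (coord c' \o icoord c) (coord c x) in
      g c x = J *m g c' x *m J^T }.

(* Curves are parametrized by R and then restricted to [0, 1]; reparametrizing
   shows that piecewise C^1 curves on [0, 1] would give the same distance. *)
Definition C1_curve (R : realType) (M : topologicalType) (n : nat)
    (A : smooth_structure R M n) (W : set M) (gam : R -> M) : Prop :=
  [/\ continuous gam, (forall t, W (gam t)) &
      forall c t, atlas A c -> dom c (gam t) ->
        derivable (coord c \o gam) t 1 /\
        {for t, continuous (derive1 (coord c \o gam))}].

Definition speed (R : realType) (M : topologicalType) (n : nat)
    (A : smooth_structure R M n) (g : tensor2 R M n) (gam : R -> M) (t : R) : R :=
  let c := chart_at A (gam t) in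
  Num.sqrt (qform (g c (gam t)) (derive1 (coord c \o gam) t)).

Definition curve_length (R : realType) (M : topologicalType) (n : nat)
    (A : smooth_structure R M n) (g : tensor2 R M n) (gam : R -> M) : \bar R :=
  (\int[@lebesgue_measure R]_(t in `[0%R, 1%R]) (speed A g gam t)%:E)%E.

(* Distance +oo between points of different components: M need not be
   connected. *)
Definition riemannian_dist (R : realType) (M : topologicalType) (n : nat)
    (A : smooth_structure R M n) (W : set M) (g : tensor2 R M n)
    (x y : M) : \bar R :=
  ereal_inf [set curve_length A g gam | gam in
    [set gam | [/\ C1_curve A W gam, gam 0 = x & gam 1 = y]]].

Definition complete_metric (R : realType) (M : topologicalType) (n : nat)
    (A : smooth_structure R M n) (W : set M) (g : tensor2 R M n) : Prop :=
  forall x_ : nat -> M, (forall j, W (x_ j)) ->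
    (forall e : R, 0 < e -> exists N : nat, forall i j : nat,
      (N <= i)%N -> (N <= j)%N ->
      (riemannian_dist A W g (x_ i) (x_ j) < e%:E)%E) ->
    exists x, W x /\
      (fun j => riemannian_dist A W g (x_ j) x) @ \oo --> 0%E.

Definition punctured (M : Type) (k : nat) (p : 'I_k -> M) : set M :=
  ~` range p.

Definition poincare_model (R : realType) (M : topologicalType) (n k : nat)
    (A : smooth_structure R M n) (p : 'I_k -> M) (g : tensor2 R M n) : Prop :=
  riemannian_metric A (punctured p) g /\
  exists phi : 'I_k -> chart R M n,
    [/\ forall i, [/\ atlas A (phi i), dom (phi i) (p i),
          coord (phi i) (p i) = 0 &
          coord (phi i) @` dom (phi i) = [set y | enorm y < 1]],
        forall i j, i != j -> dom (phi i) `&` dom (phi j) = set0 &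
        forall i x, dom (phi i) x -> x != p i ->
          let r := enorm (coord (phi i) x) in
          g (phi i) x = ((r ^+ 2 * (1 - ln r) ^+ 2)^-1)%:M].

Definition quasi_isometric (R : realType) (M : topologicalType) (n : nat)
    (A : smooth_structure R M n) (W : set M) (g w : tensor2 R M n) : Prop :=
  exists C : R, 1 <= C /\
    forall c x v, atlas A c -> dom c x -> W x ->
      C^-1 * qform (g c x) v <= qform (w c x) v <= C * qform (g c x) v.

Definition poincare_like (R : realType) (M : topologicalType) (n k : nat)
    (A : smooth_structure R M n) (p : 'I_k -> M) (w : tensor2 R M n) : Prop :=
  [/\ riemannian_metric A (punctured p) w,
      complete_metric A (punctured p) w &
      exists g, poincare_model A p g /\ quasi_isometric A (punctured p) g w].

Definition borel (M : ptopologicalType) := g_sigma_algebraType (@open M).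

(* mu is the volume element of g on W: the (unique on W) Borel measure equal to
   sqrt (det (g_ij)) dx_1 ... dx_n in every chart. *)
Definition volume_element (R : realType) (M : ptopologicalType) (n : nat)
    (A : smooth_structure R M n) (W : set M) (g : tensor2 R M n)
    (mu : {measure set (borel M) -> \bar R}) : Prop :=
  forall c (B : set (borel M)), atlas A c -> measurable B ->
    B `<=` dom c `&` W ->
    mu B = integral_Rn (fun y =>
      (\1_(coord c @` B) y * Num.sqrt (\det (g c (icoord c y))))%:E).

(* Components g^ij d_j u of the gradient in the chart c. *)
Definition gradient (R : realType) (M : topologicalType) (n : nat)
    (g : tensor2 R M n) (u : M -> R) (c : chart R M n) (x : M) : 'rV[R]_n :=
  (\row_(j < n) 'D_(delta_mx 0 j) (u \o icoord c) (coord c x))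
    *m invmx (g c x).

Definition gradient_norm (R : realType) (M : topologicalType) (n : nat)
    (A : smooth_structure R M n) (g : tensor2 R M n) (u : M -> R) (x : M) : R :=
  let c := chart_at A x in Num.sqrt (qform (g c x) (gradient g u c x)).

Definition Lp_norm (R : realType) (M : ptopologicalType) (W : set M)
    (mu : {measure set (borel M) -> \bar R}) (q : R) (u : M -> R) : \bar R :=
  ((\int[mu]_(x in W) (`|u x| `^ q)%:E) `^ q^-1)%E.

Definition in_Lp (R : realType) (M : ptopologicalType) (W : set M)
    (mu : {measure set (borel M) -> \bar R}) (q : R) (u : M -> R) : Prop :=
  measurable_fun (W : set (borel M)) (u : borel M -> R) /\
  (Lp_norm W mu q u < +oo)%E.

Definition H1_norm (R : realType) (M : ptopologicalType) (n : nat)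
    (A : smooth_structure R M n) (W : set M) (g : tensor2 R M n)
    (mu : {measure set (borel M) -> \bar R}) (u : M -> R) : \bar R :=
  (Lp_norm W mu 2 (gradient_norm A g u) + Lp_norm W mu 2 u)%E.

(* The element of the completion of C^oo(M) represented by a Cauchy sequence u_
   is identified with the L^2 limit u of u_ (the induced map from the
   completion to L^2 is injective). *)
Definition H1_approx (R : realType) (M : ptopologicalType) (n : nat)
    (A : smooth_structure R M n) (W : set M) (g : tensor2 R M n)
    (mu : {measure set (borel M) -> \bar R})
    (u_ : nat -> M -> R) (u : M -> R) : Prop :=
  [/\ forall j, smooth_function A (u_ j),
      forall e : R, 0 < e -> exists N : nat, forall i j : nat,
        (N <= i)%N -> (N <= j)%N ->
        (H1_norm A W g mu (u_ i \- u_ j)%R < e%:E)%E,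
      measurable_fun (W : set (borel M)) (u : borel M -> R) &
      (fun j => Lp_norm W mu 2 (u_ j \- u)%R) @ \oo --> 0%E].

Definition in_H1 (R : realType) (M : ptopologicalType) (n : nat)
    (A : smooth_structure R M n) (W : set M) (g : tensor2 R M n)
    (mu : {measure set (borel M) -> \bar R}) (u : M -> R) : Prop :=
  exists u_, H1_approx A W g mu u_ u.

(* u belongs to H^1 and N is its norm in the completion. *)
Definition has_H1_norm (R : realType) (M : ptopologicalType) (n : nat)
    (A : smooth_structure R M n) (W : set M) (g : tensor2 R M n)
    (mu : {measure set (borel M) -> \bar R}) (u : M -> R) (N : R) : Prop :=
  exists u_, H1_approx A W g mu u_ u /\
    (fun j => H1_norm A W g mu (u_ j)) @ \oo --> N%:E.

(* Main.v *)
Require Import Defs.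
From mathcomp Require Import all_boot all_order all_algebra.
From mathcomp Require Import all_classical all_reals all_analysis.
From mathcomp Require Import measurable_realfun ring lra.
Import Order.TTheory GRing.Theory Num.Theory.
Import numFieldNormedType.Exports.
Import Defs.

Set Implicit Arguments.
Unset Strict Implicit.
Unset Printing Implicit Defensive.

Local Open Scope classical_set_scope.
Local Open Scope ring_scope.

(** In the coordinate [t = log (1 - log |x|)] the model metric of a puncture is,
    up to bounded factors, the cusp metric [dt^2 + exp(-2t) dtheta^2], whose
    volume element is [exp(-(n-1) t) dt dtheta]. A function [exp(a t)] has a
    gradient of comparable size, so it lies in H^1 when [2 a < n - 1], and it is
    not in L^q when [q a >= n - 1]; as [2 < q], both can hold.

    The exponential is replaced by a sum of bumps, one for each [m], of height
    [lam ^ m] and supported in the dyadic shell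
    [4 * 2 ^ m <= - log |x| < 8 * 2 ^ m], where [t] is [m log 2] up to a bounded
    error. The volume of this shell is comparable to [b ^ (-m)] for
    [b = 2 ^ (n - 1)] ([dyadic_shell_le], [dyadic_shell_ge]): it consists of about
    [2 ^ m] annuli on which [|x|] varies by a factor [e], and such an annulus is
    compared with cubes. The Riemannian density is controlled by bounds for
    determinants ([det_bounds]) and the length of the gradient by its independence
    of the chart ([gradient_normE], [gradient_norm_le]).

    The number [lam] is chosen with [lam ^ 2 < b < lam ^ q]. The squared norms of
    the bumps in H^1 then form a convergent geometric series. As the supports are
    disjoint, one majorant ([tail]) controls the sum of all bumps from the [N]-th
    on, its gradient, and the rest of the infinite sum ([sum_le_tail],
    [tail_integral]). Therefore the partial sums, which are smooth on the whole
    compact manifold because each bump vanishes near the puncture and near the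
    boundary of the chart, are a Cauchy sequence in H^1 that converges in L^2 to the infinite sum ([total_H1]). The integral of
    the q-th power of the bump of index [m] grows like [(lam ^ q / b) ^ m]
    ([Lq_integral_ge]), so the infinite sum is not in L^q ([total_not_Lq]), and the
    partial sums violate every Sobolev inequality ([no_sobolev]). *)

(** * Flat functions *)

(** The functions [x^-k exp(-1/x)], extended by [0] to [x <= 0], form a family
    that is closed under differentiation up to linear combinations; this gives
    the smoothness of [exp(-1/x)] without formulas for its higher derivatives. *)
Definition flat (R : realType) (k : nat) (x : R) : R :=
  if 0 < x then x^-1 ^+ k * expR (- x^-1) else 0.

Section Flat.
Context {R : realType}.
Implicit Types (k : nat) (x : R).

Lemma flat_le0 k x : x <= 0 -> flat k x = 0.
Proof. by rewrite /flat ltNge => ->. Qed.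

Lemma flat_ge0 k x : 0 <= flat k x.
Proof.
rewrite /flat; case: ifP => // x0.
by rewrite mulr_ge0 ?expR_ge0 ?exprn_ge0 ?invr_ge0 ?ltW.
Qed.

(** The term of order [k + 2] of the exponential series at [1/x] absorbs
    [x^-k]. *)
Lemma flat_le_sqr k x : flat k x <= (k.+2)`!%:R * x ^+ 2.
Proof.
rewrite /flat; case: ifP => [x0|_]; last by rewrite mulr_ge0 ?sqr_ge0.
have t0 : 0 < x^-1 by rewrite invr_gt0.
have := @expR_ge1Dxn R x^-1 k.+1 (ltW t0).
move=> /(le_trans _) h.
have {}h : x^-1 ^+ k.+2 / k.+2`!%:R <= expR x^-1 by apply: h; rewrite lerDr.
rewrite expRN ler_pdivrMr ?expR_gt0// -ler_pdivrMl; last first.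
  by rewrite mulr_gt0 ?exprn_gt0// ltr0n fact_gt0.
apply: le_trans h; rewrite invfM -exprVn [leRHS]mulrC -mulrA.
rewrite ler_pM2l ?invr_gt0 ?ltr0n ?fact_gt0//.
by rewrite -exprD add2n.
Qed.

Lemma flat_is_derive k x :
  is_derive x 1 (flat k) (flat k.+2 x - k%:R * flat k.+1 x).
Proof.
have [x0|x0|->] := ltgtP x 0.
- rewrite !flat_le0 ?ltW// mulr0 subr0.
  apply: (@near_eq_is_derive _ _ _ (cst 0)).
  near=> y; rewrite /= flat_le0//; near: y; exact: lt_le_nbhsl.
- pose E : R -> R := fun y => expR (- y^-1).
  pose I : R -> R := fun y => y^-1.
  have dI : is_derive x 1 I (- x^-1 ^+ 2).
    have := @is_deriveV R id x 1 1 (lt0r_neq0 x0) (is_derive_id _ _).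
    by rewrite -exprVn /GRing.scale /= mulr1.
  have dE : is_derive x 1 E (expR (- x^-1) * x^-1 ^+ 2).
    have d2 := is_deriveN dI; rewrite opprK in d2.
    exact: (is_derive1_comp (is_derive_expR _) d2).
  have dX := is_deriveX k dI.
  have dM := is_deriveM dX dE.
  apply: (@near_eq_is_derive _ _ _ (I ^+ k * E)).
    near=> y; have y0 : 0 < y by near: y; exact: lt_nbhsr.
    by rewrite /flat y0 /I /E !fctE.
  apply: is_derive_eq => /=.
  rewrite /flat x0 /GRing.scale /= !fctE /E /I !exprS.
  case: k {dX dM} => [|k] /=; first by rewrite !mul0r; ring.
  by rewrite !exprS; ring.
- rewrite !flat_le0// mulr0 subr0.
  have H : (fun h => h^-1 *: ((flat k \o shift 0) (h *: 1) - flat k 0)) @ 0^'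
      --> (0 : R).
    apply/cvgr0Pnorm_le => e e0; near=> h.
    have h0 : h != 0 by near: h; exact: nbhs_dnbhs_neq.
    rewrite /= addr0 (flat_le0 k (lexx 0)) subr0 /GRing.scale /= mulr1 normrM normfV.
    rewrite (ger0_norm (flat_ge0 _ _)) ler_pdivrMl ?normr_gt0//.
    apply: le_trans (flat_le_sqr _ _) _.
    rewrite -real_normK ?num_real// expr2 mulrA [leRHS]mulrC ler_pM2r ?normr_gt0// mulrC.
    rewrite -ler_pdivlMr ?ltr0n ?fact_gt0//.
    near: h; apply: dnbhs0_le.
    by rewrite divr_gt0// ltr0n fact_gt0.
  by apply: DeriveDef; [apply/cvg_ex; exists 0 | exact/cvg_lim].
Unshelve. all: by end_near. Qed.
End Flat.

(** * Calculus of functions of class C^m *)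

Lemma near_eq_differentiable (R : realType) (V W : normedModType R)
    (f g : V -> W) (x : V) :
  {near x, f =1 g} -> differentiable f x -> differentiable g x.
Proof.
move=> fg df; have gx : f x = g x := nbhs_singleton fg.
have E : g \o shift x = cst (g x) + 'd f x +o_ 0 id.
  apply/eqaddoP => eps eps0.
  have := diff_locally df => /eqaddoP /(_ _ eps0); rewrite !near_simpl => h.
  have sfg : \forall y \near 0, f (y + x) = g (y + x).
    have : \forall z \near x, f z = g z by [].
    rewrite (near_shift 0 x (fun z => f z = g z)).
    by apply: filterS => z /=; rewrite subr0.
  near=> y.
  have -> : (g \o shift x - (cst (g x) + 'd f x)) y =
            (f \o shift x - (cst (f x) + 'd f x)) y.
    by rewrite /= !fctE /= gx (near sfg y).
  by near: y.
have dfc : continuous ('d f x) by exact: diff_continuous.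
apply/diff_locallyP; rewrite (diff_unique dfc E); split => //.
Unshelve. all: by end_near. Qed.

Section Chain.
Context {R : realType} {n : nat}.
Implicit Types (f g : 'rV[R]_n -> R) (h : R -> R) (y v : 'rV[R]_n).

Lemma is_derive_chain h (g : 'rV[R]_n -> R) y v dh :
  differentiable g y -> is_derive (g y) 1 h dh ->
  differentiable (h \o g) y /\ 'D_v (h \o g) y = dh * 'D_v g y.
Proof.
move=> dg [hd hv]; have dh' : differentiable h (g y) by exact/derivable1_diffP.
have dhg : differentiable (h \o g) y by exact: differentiable_comp.
split=> //; rewrite !deriveE// diff_comp//= deriv1E//.
by rewrite /= /GRing.scale /= derive1E hv mulrC.
Qed.

End Chain.

Section CkTheory.
Context {R : realType} {n : nat}.
Implicit Types (f g : 'rV[R]_n -> R) (V : set 'rV[R]_n) (m : nat).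

(** [Ck] is a conjunction of conditions on the germs of [f] at the points of the
    set. *)
Lemma Ck_cover m V f :
  (forall y, V y -> exists2 V', V' y & Ck m V' f) -> Ck m V f.
Proof.
elim: m f => [|m IH] f H /=.
  by move=> y /H[V' V'y]; apply.
split=> [y Vy|i].
  by have [V' V'y [fd _]] := H y Vy; exact: fd.
by apply: IH => y Vy; have [V' V'y [_ fC]] := H y Vy; exists V'; last exact: fC.
Qed.

Lemma Ck_sub m V V' f : V' `<=` V -> Ck m V f -> Ck m V' f.
Proof. by move=> VV' C; apply: Ck_cover => y /VV' Vy; exists V. Qed.

Lemma Ck_eq m V f g : open V -> (forall y, V y -> f y = g y) ->
  Ck m V f -> Ck m V g.
Proof.
move=> oV; have nearV (a b : 'rV[R]_n -> R) : (forall y, V y -> a y = b y) ->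
    forall y, V y -> {near y, a =1 b}.
  move=> ab y Vy; have : nbhs y V by exact: open_nbhs_nbhs.
  by apply: filterS.
elim: m f g => [|m IH] f g fg /=.
  move=> C y Vy; have nfg := nearV _ _ fg _ Vy.
  rewrite /prop_for /continuous_at -(fg y Vy).
  exact: cvg_trans (near_eq_cvg nfg) (C y Vy).
move=> [Cd C]; split.
  by move=> y Vy; apply: near_eq_differentiable (Cd _ Vy); exact: nearV.
move=> i; apply: IH (C i) => y Vy; apply: near_eq_derive; exact: nearV.
Qed.

Lemma CkW m V f : Ck m.+1 V f -> Ck m V f.
Proof.
elim: m f => [|m IH] f [fd fC].
  by move=> y /fd /differentiable_continuous.
by split=> // i; apply: IH; exact: fC.
Qed.

Lemma Ck_cst m V (c : R) : Ck m V (fun=> c).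
Proof.
elim: m c => [|m IH] c /=; first by move=> y _; exact: cst_continuous.
split=> [y _|i]; first exact: differentiable_cst.
rewrite (_ : 'D_ _ _ = fun=> 0)//.
by apply/funext => y; rewrite -[fun=> c]/(cst c) derive_cst.
Qed.

Lemma CkD m V f g : open V -> Ck m V f -> Ck m V g -> Ck m V (f + g).
Proof.
move=> oV; elim: m f g => [|m IH] f g.
  by move=> fC gC y Vy; apply: continuousD; [exact: fC|exact: gC].
move=> [fd fC] [gd gC]; split=> [y Vy|i].
  by apply: differentiableD; [exact: fd|exact: gd].
apply: (Ck_eq oV _ (IH _ _ (fC i) (gC i))) => y Vy.
by rewrite deriveD//; apply: diff_derivable; [exact: fd|exact: gd].
Qed.

Lemma CkM m V f g : open V -> Ck m V f -> Ck m V g -> Ck m V (f * g).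
Proof.
move=> oV; elim: m f g => [|m IH] f g.
  by move=> fC gC y Vy; apply: continuousM; [exact: fC|exact: gC].
move=> Cf Cg; have [fd fC] := Cf; have [gd gC] := Cg; split=> [y Vy|i].
  by apply: differentiableM; [exact: fd|exact: gd].
have C' := CkD oV (IH _ _ (CkW Cf) (gC i)) (IH _ _ (CkW Cg) (fC i)).
apply: (Ck_eq oV _ C') => y Vy.
by rewrite deriveM//; apply: diff_derivable; [exact: fd|exact: gd].
Qed.

Lemma Ck_sum m V (I : Type) (r : seq I) (F : I -> 'rV[R]_n -> R) : open V ->
  (forall i, Ck m V (F i)) -> Ck m V (fun y => \sum_(i <- r) F i y).
Proof.
move=> oV CF; elim: r => [|i r IH].
  by under eq_fun do rewrite big_nil; exact: Ck_cst.
by under eq_fun do rewrite big_cons; exact: (CkD oV (CF i) IH).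
Qed.

(** By the chain rule, the partial derivatives of [h \o f] are products of those
    of [f] with [h' \o f]. Hence only functions of one real variable are ever
    composed, and no chain rule of higher order is needed. *)
Lemma CkS_comp m V f (h h' : R -> R) : open V ->
  (forall y, V y -> is_derive (f y) 1 h (h' (f y))) ->
  Ck m.+1 V f -> Ck m V (h' \o f) -> Ck m.+1 V (h \o f).
Proof.
move=> oV dh [fd fC] C'; split=> [y Vy|i].
  by have [] := is_derive_chain 0 (fd y Vy) (dh y Vy).
apply: (Ck_eq oV _ (CkM oV C' (fC i))) => y Vy.
by have [_ ->] := is_derive_chain (delta_mx 0 i) (fd y Vy) (dh y Vy).
Qed.

Lemma Ck0_comp V f (h : R -> R) : (forall y, V y -> {for f y, continuous h}) ->
  Ck 0 V f -> Ck 0 V (h \o f).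
Proof. by move=> hc fc y Vy; apply: continuous_comp; [exact: fc|exact: hc]. Qed.

Lemma Ck_inv m V f : open V -> (forall y, V y -> 0 < f y) -> Ck m V f ->
  Ck m V (fun y => (f y)^-1).
Proof.
move=> oV f0; rewrite -[fun y => _]/((fun t : R => t^-1) \o f).
elim: m => [|m IH] C.
  by apply: Ck0_comp C => y Vy; apply: inv_continuous; rewrite gt_eqF// f0.
have If := IH (CkW C).
apply: (@CkS_comp m V f _ (fun t => - 1 * (t^-1 * t^-1))) => //.
  move=> y Vy; have fy0 : id (f y) != 0 by rewrite /= gt_eqF// f0.
  have := @is_deriveV R id (f y) 1 1 fy0 (is_derive_id _ _).
  by rewrite -exprVn /GRing.scale /= mulr1 expr2 mulN1r.
exact: (CkM oV (Ck_cst _ _ (-1)) (CkM oV If If)).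
Qed.

Lemma Ck_ln m V f : open V -> (forall y, V y -> 0 < f y) -> Ck m V f ->
  Ck m V (fun y => ln (f y)).
Proof.
move=> oV f0; case: m => [|m] C.
  by apply: (@Ck0_comp V f (@ln R)) C => y Vy; apply: continuous_ln; exact: f0.
apply: (@CkS_comp m V f (@ln R) (fun t => t^-1)) => //.
  by move=> y Vy; apply: is_derive1_ln; exact: f0.
by apply: Ck_inv => //; exact: CkW.
Qed.

(** The induction on [m] is for all [k] at once because the derivative of
    [flat k] involves [flat k.+1] and [flat k.+2]. *)
Lemma Ck_flat m k V f : open V -> Ck m V f -> Ck m V (fun y => flat k (f y)).
Proof.
move=> oV; elim: m k => [|m IH] k C.
  apply: (@Ck0_comp V f (flat k)) C => y Vy; apply: differentiable_continuous.
  by apply/derivable1_diffP; have [] := flat_is_derive k (f y).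
apply: (@CkS_comp m V f (flat k)
  (fun t => flat k.+2 t + - k%:R * flat k.+1 t)) => //.
  move=> y Vy; rewrite mulNr; exact: flat_is_derive.
apply: (CkD oV (IH k.+2 (CkW C))).
exact: (CkM oV (Ck_cst _ _ (- k%:R)) (IH k.+1 (CkW C))).
Qed.

End CkTheory.

(** * Determinants of matrices with bounded quadratic form *)

Section DetBounds.
Context {R : realType}.

(** Induction on the size: eliminating the first coordinate replaces [G] by its
    Schur complement, whose quadratic form is the minimum of that of [G] over
    the first coordinate and therefore obeys the same bounds. *)
Lemma det_bounds n (G : 'M[R]_n) (a b : R) : 0 < a -> G^T = G ->
  (forall v, a * (v *m v^T) 0 0 <= qform G v <= b * (v *m v^T) 0 0) ->
  a ^+ n <= \det G <= b ^+ n.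
Proof.
move=> a0; elim: n G => [|n IH] G symG Gab.
  by rewrite det_mx00 !expr0 lexx.
move: G symG Gab; rewrite -[n.+1]/(1 + n)%N => G symG Gab.
pose g := G 0 0; pose B : 'rV[R]_n := ursubmx G; pose D : 'M[R]_n := drsubmx G.
have Gblock : G = block_mx g%:M B B^T D.
  rewrite -[LHS]submxK; congr block_mx.
    apply/matrixP => i j; rewrite !ord1 !mxE eqxx mulr1n.
    by congr (G _ _); apply/val_inj.
  by rewrite /B trmx_ursub symG.
have symD : D^T = D by rewrite /D trmx_drsub symG.
have qE (t : R) (v : 'rV[R]_n) : qform G (row_mx t%:M v) =
    g * t ^+ 2 + (t * (B *m v^T) 0 0) *+ 2 + qform D v.
  rewrite /qform Gblock mul_row_block tr_row_mx mul_row_col tr_scalar_mx.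
  rewrite !mulmxDl !mul_scalar_mx !mul_mx_scalar -scalemxAl.
  rewrite -[v *m B^T]trmxK trmx_mul trmxK.
  move: (B *m v^T) (v *m D *m v^T) => X Y; rewrite !mxE eqxx mulr1n.
  by ring.
have vv (t : R) (v : 'rV[R]_n) : (row_mx t%:M v *m (row_mx t%:M v)^T) 0 0 =
    t ^+ 2 + (v *m v^T) 0 0.
  by rewrite tr_row_mx mul_row_col mxE tr_scalar_mx -scalar_mxM mxE eqxx.
have gab : a <= g <= b.
  have := Gab (row_mx 1%:M 0).
  rewrite qE vv /qform trmx0 !mulmx0 !mxE.
  by rewrite expr1n !mulr1 mulr0 mul0rn !addr0 !mulr1.
have g0 : g != 0 by rewrite gt_eqF// (lt_le_trans a0)//; case/andP: gab.
pose S : 'M[R]_n := D - g^-1 *: (B^T *m B).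
have detG : \det G = g * \det S.
  have -> : G = block_mx 1%:M 0 (g^-1 *: B^T) 1%:M *m block_mx g%:M B 0 S.
    rewrite mulmx_block !mul1mx !mul0mx !addr0 [LHS]Gblock.
    congr block_mx; last by rewrite /S -scalemxAl addrC subrK.
    by rewrite mul_mx_scalar scalerA mulfV// scale1r.
  by rewrite det_mulmx det_lblock det_ublock !det1 !mul1r det_scalar1.
have symS : S^T = S.
  by rewrite /S linearB linearZ /= trmx_mul trmxK symD.
have qS v : qform S v = qform D v - g^-1 * (B *m v^T) 0 0 ^+ 2.
  rewrite /qform /S mulmxBr mulmxBl -scalemxAr -scalemxAl.
  rewrite mulmxA -(mulmxA _ B) -[v *m B^T]trmxK trmx_mul trmxK.
  move: (B *m v^T) (v *m D *m v^T) => X Y; rewrite !mxE big_ord1 !mxE.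
  by rewrite expr2.
have Sab v : a * (v *m v^T) 0 0 <= qform S v <= b * (v *m v^T) 0 0.
  set c := (B *m v^T) 0 0.
  have /andP[h1 _] := Gab (row_mx (- (g^-1 * c))%:M v).
  have /andP[_ h2] := Gab (row_mx 0%:M v).
  move: h1 h2; rewrite !qE !vv qS -/c => h1 h2; apply/andP; split.
    apply: le_trans (le_trans _ h1) _.
      by rewrite mulrDr lerDr mulr_ge0 ?sqr_ge0// ltW.
    by rewrite le_eqVlt; apply/orP; left; apply/eqP; field.
  apply: le_trans (le_trans _ h2) _.
    rewrite expr0n /= mul0r mul0rn mulr0 !add0r lerBlDr lerDl.
    by rewrite mulr_ge0 ?sqr_ge0// invr_ge0 ltW// (lt_le_trans a0); case/andP: gab.
  by rewrite expr0n /= add0r.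
have /andP[Sa Sb] := IH _ symS Sab; case/andP: gab => ga gb.
have an0 : 0 <= a ^+ n by rewrite exprn_ge0// ltW.
rewrite detG !exprS; apply/andP; split; apply: ler_pM => //; try exact: ltW.
  by rewrite ltW// (lt_le_trans a0).
exact: le_trans Sa.
Qed.
End DetBounds.

(** * Iterated integrals *)

(** The integral of a nonnegative function is a supremum over the simple functions
    below it, so it is monotone without any measurability; the densities and
    gradients below are only ever compared with explicit functions. *)
Lemma ge0_le_integral_nonmeas d (T : measurableType d) (R : realType)
    (mu : {measure set T -> \bar R}) (D : set T) (f g : T -> \bar R) :
  (forall x, D x -> (0 <= f x)%E) -> (forall x, D x -> (f x <= g x)%E) ->
  (\int[mu]_(x in D) f x <= \int[mu]_(x in D) g x)%E.
Proof.
move=> f0 fg; rewrite !(integral_mkcond D).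
have g0 x : D x -> (0 <= g x)%E by move=> Dx; exact: le_trans (f0 _ Dx) (fg _ Dx).
rewrite !ge0_integralTE; [|by move=> x; apply: erestrict_ge0..].
apply: le_ereal_sup => _ [h /= hf <-]; exists h => // x.
by apply: le_trans (hf x) _; exact: lee_restrict.
Qed.

Section IteratedIntegral.
Context {R : realType}.
Local Open Scope ereal_scope.

Lemma integral_Rn_ge0 n (f : 'rV[R]_n -> \bar R) :
  (forall y, 0 <= f y) -> 0 <= integral_Rn f.
Proof.
elim: n f => [|n IH] f f0 /=; first exact: f0.
by apply: integral_ge0 => t _; apply: IH => y; exact: f0.
Qed.

Lemma le_integral_Rn n (f g : 'rV[R]_n -> \bar R) :
  (forall y, 0 <= f y) -> (forall y, f y <= g y) ->
  integral_Rn f <= integral_Rn g.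
Proof.
elim: n f g => [|n IH] f g f0 fg /=; first exact: fg.
apply: ge0_le_integral_nonmeas => t _; first by apply: integral_Rn_ge0 => y.
by apply: IH => y; [exact: f0|exact: fg].
Qed.

Lemma integral_Rn_box n (K a b : R) : (0 <= K)%R -> (a <= b)%R ->
  integral_Rn (fun y : 'rV[R]_n =>
    (K * \prod_(i < n) \1_`[a, b] (y ord0 i))%:E) = (K * (b - a) ^+ n)%:E.
Proof.
move=> + ab; elim: n K => [|n IH] K K0 /=; first by rewrite big_ord0 expr0.
transitivity (\int[lebesgue_measure]_(t in [set: R])
    ((K * (b - a) ^+ n)%:E * (\1_`[a, b] t)%:E)).
  apply: eq_integral => t _.
  rewrite -EFinM mulrAC -IH; last by rewrite mulr_ge0// indicE.
  congr integral_Rn; apply/funext => y; congr EFin.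
  rewrite -mulrA; congr (_ * _)%R.
  rewrite -[n.+1]/(1 + n)%N big_split_ord big_ord1 /=; congr (_ * _)%R.
    by rewrite row_mxEl mxE eqxx.
  by apply: eq_bigr => i _; rewrite row_mxEr.
rewrite ge0_integralZl//; last 2 first.
  by apply/measurable_EFinP.
  by rewrite lee_fin mulr_ge0// exprn_ge0// subr_ge0.
rewrite integral_indic// setIT /= lebesgue_measure_itv /= lte_fin.
rewrite exprSr mulrA; case: ltgtP ab => [ab|//|->] _; first by rewrite -EFinB.
by rewrite subrr mulr0 mule0.
Qed.

End IteratedIntegral.

(** * The norm of the gradient in a chart *)

Section PositiveForms.
Context {R : realType} {n : nat}.
Implicit Types (G J : 'M[R]_n) (d v : 'rV[R]_n).

Lemma posdef_unitmx G : (forall v, v != 0 -> 0 < qform G v) -> G \in unitmx.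
Proof.
move=> posG; rewrite unitmxE unitfE; apply/negP => /det0P[v v0 vG].
by have := posG _ v0; rewrite /qform vG mul0mx mxE ltxx.
Qed.

(** Under a change of coordinates with Jacobian matrix [J], the gradient vectors
    [v] and [d G^-1] of the two charts are related by [v J = d G^-1]. *)
Lemma qform_gradient_change J G d : J *m G *m J^T \in unitmx ->
  qform (J *m G *m J^T) (d *m J^T *m invmx (J *m G *m J^T)) =
  qform G (d *m invmx G).
Proof.
set H := J *m G *m J^T => uH.
have [uG uJ] : G \in unitmx /\ J^T \in unitmx.
  by move: uH; rewrite /H !unitmx_mul => /andP[/andP[]].
set v := _ *m invmx H.
have vJ : v *m J = d *m invmx G.
  apply: (can_inj (mulmxK uG)); apply: (can_inj (mulmxK uJ)).
  rewrite mulmxKV// -!mulmxA (mulmxA J) -/H /v.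
  by rewrite mulVmx// mulmx1.
by clearbody v; rewrite -vJ /qform /H trmx_mul !mulmxA.
Qed.

(** Expanding [0 <= |k d - v|^2] for the gradient [v] gives the bound with the
    inverse matrix from the one with the matrix itself. *)
Lemma qform_gradient_le G d (k : R) : G^T = G -> G \in unitmx -> 0 < k ->
  (forall v, (v *m v^T) 0 0 <= k * qform G v) ->
  qform G (d *m invmx G) <= k * (d *m d^T) 0 0.
Proof.
move=> symG uG k0 Gk; set v := d *m invmx G.
have qE : qform G v = (d *m v^T) 0 0 by rewrite /qform /v mulmxKV.
clearbody v.
have := Gk v; have : 0 <= ((k *: d - v) *m (k *: d - v)^T) 0 0.
  by rewrite mxE sumr_ge0// => i _; rewrite [_^T _ _]mxE -expr2 sqr_ge0.
have -> : ((k *: d - v) *m (k *: d - v)^T) 0 0 =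
    k ^+ 2 * (d *m d^T) 0 0 - (k * (d *m v^T) 0 0) *+ 2 + (v *m v^T) 0 0.
  rewrite linearB linearZ /= mulmxBl !mulmxBr -!scalemxAl -!scalemxAr.
  rewrite -[v *m d^T]trmxK trmx_mul trmxK.
  by move: (d *m d^T) (d *m v^T) (v *m v^T) => X Y Z; rewrite !mxE; ring.
rewrite -qE => h1 h2; rewrite -(ler_pM2l k0); nra.
Qed.

End PositiveForms.

Lemma differentiable_rV (R : realType) (n m : nat)
    (f : 'rV[R]_n -> 'rV[R]_m) (y : 'rV[R]_n) :
  (forall i, differentiable (fun z => f z 0 i) y) -> differentiable f y.
Proof.
move=> df.
have -> : f = \sum_(i < m) (fun z => f z 0 i *: delta_mx 0 i).
  by apply/funext => z; rewrite fct_sumE [LHS]row_sum_delta.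
by apply: differentiable_sum => i; exact: differentiableZl.
Qed.

Section Charts.
Context {R : realType} {n : nat} {M : topologicalType}.
Variable (A : smooth_structure R M n).
Implicit Types (c : chart R M n) (x : M) (W : set M) (u : M -> R).

Lemma chart_atP x : atlas A (chart_at A x) /\ dom (chart_at A x) x.
Proof. by rewrite /chart_at; case: cid. Qed.

Lemma near_icoord c x (P : set M) : dom c x -> nbhs x P ->
  \forall y \near coord c x, P (icoord c y).
Proof.
move=> cx xP.
have /(_ P) : {for coord c x, continuous (icoord c)}.
  by apply: icoord_continuous; exists x.
by rewrite /= coordK//; exact.
Qed.

Lemma near_dom c x : dom c x -> nbhs x (dom c).
Proof. by move=> cx; apply: open_nbhs_nbhs; split=> //; exact: dom_open. Qed.

Lemma open_img c W : open W -> open (img c W).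
Proof.
move=> oW; rewrite openE => _ [x [cx Wx] <-].
have nW : nbhs x W by apply: open_nbhs_nbhs; split.
have := near_icoord cx nW.
have : nbhs (coord c x) (coord c @` dom c).
  by apply: open_nbhs_nbhs; split; [exact: img_open|exists x].
apply: filterS2 => y [z cz <-]; rewrite coordK// => Wz.
by exists z.
Qed.

Lemma differentiable_transition c c' x : atlas A c -> atlas A c' ->
  dom c x -> dom c' x -> differentiable (coord c' \o icoord c) (coord c x).
Proof.
move=> Ac Ac' cx c'x; apply: differentiable_rV => i.
have [dT _] := atlas_smooth Ac Ac' i 1%N; apply: dT; by exists x.
Qed.

Definition partials u c x : 'rV[R]_n :=
  \row_(j < n) 'D_(delta_mx 0 j) (u \o icoord c) (coord c x).

(** The chain rule; [jacobian] acts on row vectors from the right, so row vectors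
    of partial derivatives are multiplied by its transpose. *)
Lemma partials_change u c c' x : atlas A c -> atlas A c' ->
  dom c x -> dom c' x -> differentiable (u \o icoord c') (coord c' x) ->
  partials u c x = partials u c' x *m
    (jacobian (coord c' \o icoord c) (coord c x))^T.
Proof.
move=> Ac Ac' cx c'x du.
set T := coord c' \o icoord c; set y := coord c x.
have Ty : T y = coord c' x by rewrite /T /= coordK.
have dT : differentiable T y by exact: differentiable_transition.
have near_u : {near y, u \o icoord c =1 (u \o icoord c') \o T}.
  apply: filterS (near_icoord cx (near_dom c'x)) => z c'z /=.
  by rewrite /T /= coordK.
apply/rowP => j; rewrite !mxE (near_eq_derive _ near_u).
have du' : differentiable (u \o icoord c') (T y) by rewrite Ty.
rewrite deriveE; last exact: differentiable_comp.
rewrite diff_comp//= -[X in _ ('d T y X)]/(delta_mx 0 j).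
rewrite -mul_rV_lin1 -/(jacobian T y) -rowE [row _ _]row_sum_delta linear_sum.
apply: eq_bigr => k _; rewrite linearZ /= !mxE Ty [X in _ = X * _]deriveE//.
by rewrite /GRing.scale /= mulrC.
Qed.

(** The definition of [gradient_norm] uses an unspecified chart around [x]. *)
Lemma gradient_normE W (g : tensor2 R M n) u c x :
  riemannian_metric A W g -> atlas A c -> dom c x -> W x ->
  differentiable (u \o icoord c) (coord c x) ->
  gradient_norm A g u x = Num.sqrt (qform (g c x) (gradient g u c x)).
Proof.
move=> rg Ac cx Wx du; have [Ac0 c0x] := chart_atP x.
rewrite /gradient_norm; congr Num.sqrt; set c0 := chart_at A x.
have gE := metric_change rg Ac0 Ac c0x cx Wx.
rewrite /gradient -/(partials u c0 x) -/(partials u c x).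
rewrite (partials_change Ac0 Ac c0x cx du) gE; apply: qform_gradient_change.
rewrite -gE; apply: posdef_unitmx => v; exact: (metric_pos rg).
Qed.

Lemma gradient_norm_le W (g : tensor2 R M n) u c x (k : R) :
  riemannian_metric A W g -> atlas A c -> dom c x -> W x ->
  differentiable (u \o icoord c) (coord c x) ->
  0 < k -> (forall v, (v *m v^T) 0 0 <= k * qform (g c x) v) ->
  gradient_norm A g u x ^+ 2 <=
  k * \sum_(j < n) 'D_(delta_mx 0 j) (u \o icoord c) (coord c x) ^+ 2.
Proof.
move=> rg Ac cx Wx du k0 kg; rewrite (gradient_normE rg Ac cx Wx du).
have [q0|q0] := leP 0 (qform (g c x) (gradient g u c x)); last first.
  rewrite (ler0_sqrtr (ltW q0)) expr0n; apply: mulr_ge0; first exact: ltW.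
  by apply: sumr_ge0 => j _; exact: sqr_ge0.
rewrite sqr_sqrtr// /gradient -/(partials u c x).
have -> : \sum_(j < n) 'D_(delta_mx 0 j) (u \o icoord c) (coord c x) ^+ 2 =
    (partials u c x *m (partials u c x)^T) 0 0.
  by rewrite mxE; apply: eq_bigr => j _; rewrite !mxE expr2.
apply: qform_gradient_le => //; first exact: (metric_sym rg).
apply: posdef_unitmx => v; exact: (metric_pos rg).
Qed.

Lemma gradient_norm_eq0 (g : tensor2 R M n) u x :
  {near x, u =1 cst 0} -> gradient_norm A g u x = 0.
Proof.
move=> u0; have [Ac cx] := chart_atP x; rewrite /gradient_norm.
set c := chart_at A x; rewrite /gradient (_ : \row_j _ = 0).
  by rewrite mul0mx /qform !mul0mx mxE sqrtr0.
apply/rowP => j; rewrite !mxE (_ : 'D_ _ _ _ = 'D_(delta_mx 0 j) (cst 0) (coord c x)).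
  by rewrite derive_cst.
by apply: near_eq_derive; exact: (near_icoord cx u0).
Qed.

Lemma smooth_continuous u : smooth_function A u -> continuous u.
Proof.
move=> su x; have [c [Ac cx]] := atlas_cover A x.
have uc : {for coord c x, continuous (u \o icoord c)}.
  by have := su c Ac 0%N; apply; exists x.
have E : {near x, (u \o icoord c) \o coord c =1 u}.
  by apply: filterS (near_dom cx) => z cz /=; rewrite coordK.
rewrite /prop_for /continuous_at -(nbhs_singleton E).
have := continuous_comp (coord_continuous cx) uc.
exact: cvg_trans (near_eq_cvg E).
Qed.

End Charts.

(** * The Euclidean norm *)

Section Euclidean.
Context {R : realType} {n : nat}.
Implicit Types (y v : 'rV[R]_n).

Definition sqnorm y : R := \sum_(i < n) y 0 i ^+ 2.

Lemma sqnorm_ge0 y : 0 <= sqnorm y.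
Proof. by apply: sumr_ge0 => i _; exact: sqr_ge0. Qed.

Lemma sqnormE y : sqnorm y = (y *m y^T) 0 0.
Proof. by rewrite mxE; apply: eq_bigr => i _; rewrite mxE expr2. Qed.

Lemma sqnorm0 : sqnorm 0 = 0.
Proof. by rewrite sqnormE mul0mx mxE. Qed.

Lemma sqnorm_gt0 y : y != 0 -> 0 < sqnorm y.
Proof.
move=> y0; rewrite lt_neqAle sqnorm_ge0 andbT eq_sym; apply: contra y0 => /eqP.
move=> /psumr_eq0P y2; apply/eqP/rowP => i; rewrite mxE; apply/eqP.
by rewrite -sqrf_eq0; apply/eqP/y2 => // j _; exact: sqr_ge0.
Qed.

Lemma enorm_lt1 y : (enorm y < 1) = (sqnorm y < 1).
Proof. by rewrite /enorm -/(sqnorm y) -[X in _ < X]sqrtr1 ltr_sqrt. Qed.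

Lemma coord_le_sqnorm y i : y 0 i ^+ 2 <= sqnorm y.
Proof.
by rewrite /sqnorm (bigD1 i)//= lerDl sumr_ge0// => j _; exact: sqr_ge0.
Qed.

Lemma is_derive_entry y v i : is_derive y v (fun z : 'rV[R]_n => z 0 i) (v 0 i).
Proof.
have H : (fun h => h^-1 *: (((fun z : 'rV[R]_n => z 0 i) \o shift y) (h *: v)
    - y 0 i)) @ 0^' --> v 0 i.
  apply: cvg_near_cst; near=> h.
  have h0 : h != 0 by near: h; exact: nbhs_dnbhs_neq.
  by rewrite /= !mxE addrK /GRing.scale /= mulKf.
by apply: DeriveDef; [apply/cvg_ex; exists (v 0 i) | exact/cvg_lim].
Unshelve. all: by end_near. Qed.

Lemma differentiable_sqnorm y : differentiable sqnorm y.
Proof.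
have -> : sqnorm = \sum_(i < n) (fun z : 'rV[R]_n => z 0 i) ^+ 2.
  by apply/funext => z; rewrite fct_sumE.
apply: differentiable_sum => i; apply: differentiableX.
exact: differentiable_coord.
Qed.

Lemma derive_sqnorm y j : 'D_(delta_mx 0 j) sqnorm y = y 0 j *+ 2.
Proof.
have -> : sqnorm = \sum_(i < n) (fun z : 'rV[R]_n => z 0 i) ^+ 2.
  by apply/funext => z; rewrite fct_sumE.
have dy i := is_deriveX 2 (is_derive_entry y (delta_mx 0 j) i).
rewrite (derive_val (is_derive := is_derive_sum dy)).
rewrite (bigD1 j)//= big1 => [|i ij]; last first.
  by rewrite mxE eqxx (negbTE ij) /GRing.scale /= mulr0.
by rewrite mxE !eqxx addr0 /GRing.scale /= mulr1 expr1 mulr_natl.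
Qed.

Lemma sqnorm_continuous : continuous sqnorm.
Proof. by move=> y; exact/differentiable_continuous/differentiable_sqnorm. Qed.

Lemma closed_annulus_compact (a b : R) :
  compact [set y : 'rV[R]_n | a <= sqnorm y <= b].
Proof.
apply: bounded_closed_compact.
  exists (b + 1); split; first exact: num_real.
  move=> B bB y /andP[_ yb]; rewrite /= -[`|y|]/(mx_norm y) mx_normrE.
  have B0 : 0 <= B.
    by rewrite ltW// (le_lt_trans _ bB)// addr_ge0// (le_trans _ yb)// sqnorm_ge0.
  apply: bigmax_le => // -[i j] _ /=; rewrite ord1 leNgt; apply/negP => yB.
  have := le_trans (coord_le_sqnorm y j) yb; rewrite leNgt => /negP; apply.
  rewrite -real_normK ?num_real//; nra.
rewrite (_ : [set _ | _] = [set y | a <= sqnorm y] `&` [set y | sqnorm y <= b]).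
  apply: closedI.
    exact: (@preimage_closed _ _ sqnorm [set x | a <= x]
      (fun y _ => @sqnorm_continuous y) (@closed_ge R a)).
  exact: (@preimage_closed _ _ sqnorm [set x | x <= b]
      (fun y _ => @sqnorm_continuous y) (@closed_le R b)).
by apply/seteqP; split => y /=; [move=> /andP|move=> [-> ->]].
Qed.

End Euclidean.

(** * Shells of the cusp *)

Lemma closed_borel (M : ptopologicalType) (B : set (borel M)) :
  closed (B : set M) -> measurable B.
Proof.
move=> cB; rewrite -[B]setCK; apply: measurableC.
by apply: sub_sigma_algebra; exact: closed_openC.
Qed.

(** In the cusp [|x| < 1] of the chart, the function [height] is [- log |x|],
    the arc length parameter of the rotationally symmetric cylinder metric
    [|dx|^2 / |x|^2]; the value [0] outside of the cusp and at its tip is a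
    default value. *)
Definition height (R : realType) (M : topologicalType) (n : nat)
    (phi : chart R M n) (x : M) : R :=
  if `[< dom phi x >] then - ln (sqnorm (coord phi x)) / 2 else 0.

Definition shell (R : realType) (M : topologicalType) (n : nat)
    (phi : chart R M n) (a b : R) : set M := [set x | a <= height phi x < b].

Section PuncturedBall.
Context {R : realType} {M : ptopologicalType} {n : nat}.
Context {phi : chart R M n} {p0 : M}.
Context (hM : hausdorff_space M).
Context (phip0 : dom phi p0) (phi0 : coord phi p0 = 0).
Context (ball1 : coord phi @` dom phi = [set y | enorm y < 1]).
Implicit Types (x : M) (a b : R).

Lemma coord_inj x : dom phi x -> coord phi x = 0 -> x = p0.
Proof. by move=> dx x0; rewrite -(coordK dx) x0 -phi0 coordK. Qed.

Lemma ball_icoord (y : 'rV[R]_n) : sqnorm y < 1 ->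
  dom phi (icoord phi y) /\ coord phi (icoord phi y) = y.
Proof.
move=> y1; have [x dx <-] : (coord phi @` dom phi) y.
  by rewrite ball1 /= enorm_lt1.
by rewrite coordK.
Qed.

Lemma height_cusp x : dom phi x -> x != p0 ->
  [/\ 0 < height phi x, sqnorm (coord phi x) = expR (- height phi x) ^+ 2
    & enorm (coord phi x) = expR (- height phi x)].
Proof.
move=> dx xp; have y0 : 0 < sqnorm (coord phi x).
  by apply: sqnorm_gt0; apply: contra xp => /eqP /(coord_inj dx) ->.
have y1 : sqnorm (coord phi x) < 1.
  have : (coord phi @` dom phi) (coord phi x) by exists x.
  by rewrite ball1 /= enorm_lt1.
have hE : height phi x = - ln (sqnorm (coord phi x)) / 2.
  by rewrite /height; case: asboolP.
have sE : sqnorm (coord phi x) = expR (- height phi x) ^+ 2.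
  rewrite -expRM_natl hE mulNr opprK mulrC divfK ?pnatr_eq0// lnK//.
split => //; last by rewrite /enorm -/(sqnorm _) sE sqrtr_sqr ger0_norm ?expR_ge0.
by rewrite hE divr_gt0// oppr_gt0 ln_lt0// y0.
Qed.

Lemma height_gt0 x : 0 < height phi x -> dom phi x /\ x != p0.
Proof.
rewrite /height; case: asboolP => [dx h|_]; last by rewrite ltxx.
split=> //; apply: contraTneq h => ->.
by rewrite phi0 sqnorm0 ln0// oppr0 mul0r ltxx.
Qed.

Lemma near_height_gt0 x : 0 < height phi x -> \forall z \near x, 0 < height phi z.
Proof.
move=> /height_gt0[dx xp]; have := near_dom dx.
have : nbhs x (~` [set p0]).
  apply: open_nbhs_nbhs; split; last exact/eqP.
  exact/closed_openC/accessible_closed_set1/hausdorff_accessible.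
apply: filterS2 => z zp dz.
by have [] := height_cusp dz (introN eqP zp).
Qed.

(** The slab is the image of a compact annulus under the inverse of the chart, and
    compact sets are closed in a Hausdorff space. In particular the slab stays
    away from the boundary of the domain of the chart. *)
Lemma closed_slab a b : 0 < a -> closed [set x | a <= height phi x <= b].
Proof.
move=> a0; pose B := [set y : 'rV[R]_n | expR (- b) ^+ 2 <= sqnorm y <= expR (- a) ^+ 2].
have BE y : B y -> sqnorm y < 1.
  move=> /andP[_ /le_lt_trans]; apply; rewrite expr_lt1// ?expR_ge0//.
  by rewrite expR_lt1 oppr_lt0.
have -> : [set x | a <= height phi x <= b] = icoord phi @` B.
  apply/seteqP; split => [x /= /andP[ax xb]|_ [y By <-]] /=.
    have [dx xp] := height_gt0 (lt_le_trans a0 ax).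
    exists (coord phi x); last exact: coordK.
    have [_ sE _] := height_cusp dx xp; rewrite /B /= sE.
    by rewrite !ler_sqr ?nnegrE ?expR_ge0// !ler_expR !lerN2 ax xb.
  have [dy cy] := ball_icoord (BE _ By).
  have yp : icoord phi y != p0.
    apply/eqP => yp; move: By; rewrite -cy yp phi0 /B /= sqnorm0.
    by rewrite leNgt exprn_gt0// expR_gt0.
  have [_ sE _] := height_cusp dy yp; move: By; rewrite /B /= -{1 2}cy sE.
  by rewrite !ler_sqr ?nnegrE ?expR_ge0// !ler_expR !lerN2 andbC.
apply: compact_closed => //; apply: continuous_compact.
  apply: continuous_in_subspaceT => y; rewrite inE => /BE y1.
  by apply: icoord_continuous; rewrite ball1 /= enorm_lt1.
exact: closed_annulus_compact.
Qed.

Lemma measurable_shell a b : 0 < a -> measurable (shell phi a b : set (borel M)).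
Proof.
move=> a0; have [ba|ab] := leP b a.
  rewrite (_ : shell phi a b = set0); first exact: measurable0.
  apply/seteqP; split => x //= /andP[ax xb].
  by have := lt_le_trans xb (le_trans ba ax); rewrite ltxx.
rewrite (_ : shell phi a b = [set x | a <= height phi x <= b] `\`
    [set x | b <= height phi x <= b]).
  apply: measurableD; apply: closed_borel; apply: closed_slab => //.
  exact: lt_trans ab.
apply/seteqP; split => [x /andP[ax xb]|x [/andP[ax xb] bx]].
  by split; [rewrite /= ax ltW|rewrite /= leNgt xb].
rewrite /shell /= ax ltNge; apply/negP => bx'; apply: bx.
by rewrite /= bx' xb.
Qed.

End PuncturedBall.

(** * Volume of the shells *)

Section DyadicArithmetic.
Context {R : realType}.
Implicit Types (X Q D : R) (n : nat).

Lemma dyadic_upper n Q X : (0 < n)%N -> 0 < Q -> 0 < X ->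
  4 * X * (Q / (1 + 4 * X)) ^+ n <= Q ^+ n / X ^+ n.-1.
Proof.
case: n => // n _ Q0 X0 /=; have X4 : 0 < 4 * X by exact: mulr_gt0.
have X5 : 0 < 1 + 4 * X by rewrite addr_gt0.
apply: (@le_trans _ _ (4 * X * (Q / (4 * X)) ^+ n.+1)).
  rewrite ler_pM2l// ler_pXn2r ?nnegrE ?divr_ge0 ?(ltW Q0) ?(ltW X4) ?(ltW X5)//.
  by rewrite ler_pM2l// lef_pV2 ?posrE// lerDr.
have -> : 4 * X * (Q / (4 * X)) ^+ n.+1 = Q ^+ n.+1 / (4 * X) ^+ n.
  by rewrite expr_div_n (exprS (4 * X)); field; rewrite expf_neq0 ?gt_eqF.
rewrite ler_pM2l ?exprn_gt0// lef_pV2 ?posrE ?exprn_gt0//.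
rewrite lerXn2r ?nnegrE ?(ltW X0) ?(ltW X4)//.
by rewrite ler_peMl ?ler1n// ltW.
Qed.

Lemma dyadic_lower n D X : (0 < n)%N -> 0 < D -> 1 <= X ->
  2 / (9 * D) ^+ n / X ^+ n.-1 <= 2 * X * (D * (2 + 7 * X)) ^- n.
Proof.
case: n => // n _ D0 X1 /=; have X0 : 0 < X by exact: lt_le_trans X1.
have D9 : 0 < 9 * D by rewrite mulr_gt0.
have X9 : 0 < 9 * D * X by rewrite mulr_gt0.
have X7 : 0 < D * (2 + 7 * X) by rewrite mulr_gt0// addr_gt0// mulr_gt0.
have -> : 2 / (9 * D) ^+ n.+1 / X ^+ n = 2 * X * (9 * D * X) ^- n.+1.
  by rewrite (exprMn _ (9 * D)) (exprS X); field; rewrite !expf_neq0 ?gt_eqF.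
rewrite ler_pM2l ?mulr_gt0// lef_pV2 ?posrE ?exprn_gt0//.
rewrite ler_pXn2r ?nnegrE ?(ltW X7) ?(ltW X9)//.
by rewrite -mulrA mulrCA ler_pM2l//; lra.
Qed.

End DyadicArithmetic.

(** The factor [|x| (1 - log |x|)]: the model metric is
    [|dx|^2 / (cusp_scale x)^2]. *)
Definition cusp_scale (R : realType) (M : topologicalType) (n : nat)
    (phi : chart R M n) (x : M) : R :=
  expR (- height phi x) * (1 + height phi x).

Section CuspVolume.
Context {R : realType} {M : ptopologicalType} {n : nat}.
Context {A : smooth_structure R M n} {W : set M} {w : tensor2 R M n}.
Context {mu : {measure set (borel M) -> \bar R}}.
Context {phi : chart R M n} {p0 : M} {C : R}.
Context (hM : hausdorff_space M) (n0 : (0 < n)%N) (C1 : 1 <= C).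
Context (Aphi : atlas A phi).
Context (phip0 : dom phi p0) (phi0 : coord phi p0 = 0).
Context (ball1 : coord phi @` dom phi = [set y | enorm y < 1]).
Context (WP : forall x, dom phi x -> x != p0 -> W x).
Context (w_sym : forall x, dom phi x -> x != p0 -> (w phi x)^T = w phi x).
Context (w_bounds : forall x v, dom phi x -> x != p0 ->
  C^-1 * (cusp_scale phi x ^- 2 * sqnorm v) <= qform (w phi x) v
    <= C * (cusp_scale phi x ^- 2 * sqnorm v)).
Context (vol : volume_element A W w mu).
Implicit Types (x : M) (a b : R).

Let C0 : 0 < C := lt_le_trans ltr01 C1.

Lemma cusp_scale_gt0 x : dom phi x -> x != p0 -> 0 < cusp_scale phi x.
Proof.
move=> dx xp; have [h0 _ _] := height_cusp phip0 phi0 ball1 dx xp.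
by rewrite mulr_gt0 ?expR_gt0// addr_gt0.
Qed.

(** The quasi-isometry constant [C] is used instead of its square root, which is
    harmless because [1 <= C]. *)
Lemma cusp_density x : dom phi x -> x != p0 ->
  (C^-1 / cusp_scale phi x) ^+ n <= Num.sqrt (\det (w phi x))
    <= (C / cusp_scale phi x) ^+ n.
Proof.
move=> dx xp; set t := cusp_scale phi x; have t0 : 0 < t by exact: cusp_scale_gt0.
have V0 : 0 < C^-1 by rewrite invr_gt0.
have tV0 : 0 < t ^- 2 by rewrite invr_gt0 exprn_gt0.
have V1 : C^-1 <= 1 by rewrite invf_le1.
have /andP[h1 h2] : (C^-1 * t ^- 2) ^+ n <= \det (w phi x) <= (C * t ^- 2) ^+ n.
  apply: det_bounds; first exact: mulr_gt0.
    exact: w_sym.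
  by move=> v; rewrite -!mulrA -sqnormE; exact: w_bounds.
have ge0 (c : R) : 0 < c -> 0 <= (c / t) ^+ n.
  by move=> c0; rewrite exprn_ge0// divr_ge0// ltW.
apply/andP; split.
  rewrite -[leLHS]ger0_norm ?ge0// -sqrtr_sqr ler_sqrt; last first.
    by rewrite (le_trans _ h1)// exprn_ge0// mulr_ge0// ltW.
  apply: le_trans h1; rewrite exprAC expr_div_n ler_pXn2r// ?nnegrE.
  - by rewrite ler_pM2r// expr2 ler_piMr// ltW.
  - by rewrite mulr_ge0 ?exprn_ge0 ?ltW.
  - by rewrite mulr_ge0 ?ltW.
rewrite -[leRHS]ger0_norm ?ge0// -sqrtr_sqr ler_wsqrtr//.
apply: le_trans h2 _; rewrite [leRHS]exprAC [in leRHS]expr_div_n ler_pXn2r// ?nnegrE.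
- by rewrite ler_pM2r// expr2 ler_peMr// ltW.
- by rewrite mulr_ge0 ?ltW.
- by rewrite mulr_ge0 ?exprn_ge0 ?ltW.
Qed.

Lemma shell_cusp a b x : 0 < a -> shell phi a b x -> dom phi x /\ x != p0.
Proof.
by move=> a0 /andP[ax _]; exact: (height_gt0 phi0 (lt_le_trans a0 ax)).
Qed.

Lemma shell_volume a b : 0 < a -> mu (shell phi a b) =
  integral_Rn (fun y => (\1_(coord phi @` shell phi a b) y *
    Num.sqrt (\det (w phi (icoord phi y))))%:E).
Proof.
move=> a0; apply: vol => //.
  exact: (measurable_shell hM phip0 phi0 ball1).
by move=> x /(shell_cusp a0)[dx xp]; split=> //; exact: WP.
Qed.

(** The annulus lies in the cube [[- exp(-a), exp(-a)]^n], whose volume cancels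
    the factor [|x|^-n] of the density; what remains is [(1 - log |x|)^-n]. *)
Lemma unit_shell_le a : 0 < a ->
  (mu (shell phi a (a + 1)) <= ((2 * C * expR 1 / (1 + a)) ^+ n)%:E)%E.
Proof.
move=> a0; rewrite shell_volume//.
set r := expR (- a); have r0 : 0 < r := expR_gt0 _.
pose K := (C * expR 1 / (r * (1 + a))) ^+ n.
have a1 : 0 < 1 + a by rewrite addr_gt0.
have K0 : 0 <= K.
  by rewrite exprn_ge0// divr_ge0 ?mulr_ge0 ?expR_ge0 ?ltW.
have -> : (2 * C * expR 1 / (1 + a)) ^+ n = K * (r - - r) ^+ n.
  by rewrite /K -exprMn; congr (_ ^+ n); field; rewrite !gt_eqF.
rewrite -integral_Rn_box//; last by rewrite (@le_trans _ _ 0)// ?oppr_le0 ltW.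
apply: le_integral_Rn => y.
  by rewrite lee_fin mulr_ge0 ?sqrtr_ge0// indicE.
rewrite lee_fin indicE; have [|_] := boolP (y \in _); last first.
  by rewrite mul0r mulr_ge0// prodr_ge0// => i _; rewrite indicE.
rewrite inE mul1r => -[x Sx <-]; have [dx xp] := shell_cusp a0 Sx.
have /andP[ax xa] := Sx.
have [h0 sE _] := height_cusp phip0 phi0 ball1 dx xp.
have rx : expR (- height phi x) <= r by rewrite ler_expR lerN2.
rewrite big1 => [|i _]; last first.
  rewrite indicE mem_set// /= in_itv /=.
  rewrite -ler_norml -(ler_pXn2r (n := 2))// ?nnegrE//; last exact: ltW.
  rewrite real_normK ?num_real//; apply: le_trans (coord_le_sqnorm _ _) _.
  by rewrite sE ler_pXn2r ?nnegrE ?expR_ge0.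
rewrite mulr1 coordK//; have /andP[_] := cusp_density dx xp.
move=> /le_trans; apply; rewrite /K ler_pXn2r ?nnegrE//; last 2 first.
- by rewrite divr_ge0 ?ltW// cusp_scale_gt0.
- by rewrite divr_ge0 ?mulr_ge0 ?expR_ge0 ?ltW.
have scale_ge : r * (1 + a) <= expR 1 * cusp_scale phi x.
  rewrite /cusp_scale mulrA; apply: ler_pM => //; try exact: ltW.
    by rewrite -expRD ler_expR; lra.
  by rewrite lerD2l.
rewrite ler_pdivrMr ?cusp_scale_gt0// mulrAC ler_pdivlMr ?mulr_gt0//.
by rewrite -mulrA ler_pM2l.
Qed.

(** The annulus contains the cube of side [alpha = exp(-a) / (2 sqrt n)] with
    all coordinates between [alpha] and [2 alpha]. *)
Lemma unit_shell_ge a : 0 < a ->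
  (((2 * C * Num.sqrt n%:R * (2 + a)) ^- n)%:E <= mu (shell phi a (a + 1)))%E.
Proof.
move=> a0; rewrite shell_volume//.
set r := expR (- a); have r0 : 0 < r := expR_gt0 _.
have sn0 : 0 < Num.sqrt n%:R :> R by rewrite sqrtr_gt0 ltr0n.
have a2 : 0 < 2 + a by rewrite addr_gt0.
pose al := r / (2 * Num.sqrt n%:R).
have al0 : 0 < al by rewrite divr_gt0// mulr_gt0.
pose K := (C^-1 / (r * (2 + a))) ^+ n.
have K0 : 0 <= K.
  by rewrite exprn_ge0// divr_ge0 ?invr_ge0 ?mulr_ge0 ?ltW.
have -> : (2 * C * Num.sqrt n%:R * (2 + a)) ^- n = K * (2 * al - al) ^+ n.
  rewrite /K -exprMn -exprVn; congr (_ ^+ n); rewrite /al.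
  by field; rewrite !gt_eqF.
rewrite -integral_Rn_box//; last by rewrite mulr2n mulrDl !mul1r lerDl ltW.
apply: le_integral_Rn => y.
  by rewrite lee_fin mulr_ge0// prodr_ge0// => i _; rewrite indicE.
rewrite lee_fin.
have [/existsP[i yi]|/existsPn yal] :=
    boolP [exists i : 'I_n, y 0 i \notin `[al, 2 * al]].
  rewrite (bigD1 i)//= indicE memNset ?mul0r ?mulr0; last exact/negP.
  by rewrite mulr_ge0 ?sqrtr_ge0// indicE.
have {}yal i : al <= y 0 i <= 2 * al by have := yal i; rewrite negbK in_itv.
have al2 : n%:R * al ^+ 2 = (r / 2) ^+ 2.
  rewrite /al !expr_div_n exprMn sqr_sqrtr ?ler0n//.
  by field; rewrite pnatr_eq0 -lt0n n0.
have ge_r : (r / 2) ^+ 2 <= sqnorm y.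
  rewrite -al2 /sqnorm mulr_natl -[X in _ *+ X]card_ord -sumr_const.
  apply: ler_sum => i _; have /andP[yi _] := yal i.
  by rewrite ler_pXn2r ?nnegrE ?(le_trans (ltW al0) yi)// ltW.
have le_r : sqnorm y <= r ^+ 2.
  have -> : r ^+ 2 = n%:R * (2 * al) ^+ 2 by rewrite exprMn mulrCA al2; field.
  rewrite /sqnorm mulr_natl -[X in _ *+ X]card_ord -sumr_const.
  apply: ler_sum => i _; have /andP[yi yi2] := yal i.
  by rewrite ler_pXn2r ?nnegrE ?(le_trans (ltW al0) yi)// mulr_ge0// ltW.
have y1 : sqnorm y < 1.
  by apply: le_lt_trans le_r _; rewrite expr_lt1 ?ltW// expR_lt1 oppr_lt0.
have [dx yE] := ball_icoord ball1 y1; set x := icoord phi y in dx yE *.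
have xp : x != p0.
  apply: contraTneq ge_r => xp; rewrite -yE xp phi0 sqnorm0 -ltNge.
  by rewrite exprn_gt0// divr_gt0.
have [h0 sE _] := height_cusp phip0 phi0 ball1 dx xp.
have ax : a <= height phi x.
  rewrite -lerN2 -ler_expR -(ler_pXn2r (n := 2))// ?nnegrE ?expR_ge0//.
  by rewrite -sE yE.
have xa : height phi x < a + 1.
  rewrite -ltrN2 -ltr_expR -(ltr_pXn2r (n := 2))// ?nnegrE ?expR_ge0//.
  rewrite -sE yE; apply: lt_le_trans ge_r.
  rewrite ltr_pXn2r// ?nnegrE ?expR_ge0 ?divr_ge0// ?ltW//.
  rewrite opprD expRD -/r ltr_pM2l// expRN ltf_pV2 ?posrE ?expR_gt0//.
  by have := @expR_gt1Dx R 1 (oner_neq0 _); rewrite -[1 + 1]/(2 : R).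
rewrite big1 => [|i _]; last by rewrite indicE mem_set//= in_itv /=.
rewrite indicE mem_set ?mul1r ?mulr1; last first.
  by exists x => //; apply/andP.
have s0 := cusp_scale_gt0 dx xp; have ra0 : 0 < r * (2 + a) by rewrite mulr_gt0.
have scale_le : cusp_scale phi x <= r * (2 + a).
  by rewrite /cusp_scale; apply: ler_pM; rewrite ?expR_ge0 ?ler_expR ?lerN2//; lra.
have /andP[+ _] := cusp_density dx xp; apply: le_trans.
rewrite /K ler_pXn2r ?nnegrE// ?divr_ge0 ?invr_ge0 ?(ltW C0) ?(ltW s0) ?(ltW ra0)//.
by rewrite ler_pM2l ?invr_gt0// lef_pV2 ?posrE.
Qed.

Lemma shellS a (k : nat) : 0 < a -> (mu (shell phi a (a + k.+1%:R)) =
  mu (shell phi a (a + k%:R)) + mu (shell phi (a + k%:R) (a + k%:R + 1)))%E.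
Proof.
move=> a0; have ak : 0 < a + k%:R by rewrite ltr_wpDr.
rewrite -measureU; last 3 first.
- exact: (measurable_shell hM phip0 phi0 ball1).
- exact: (measurable_shell hM phip0 phi0 ball1).
- apply/seteqP; split=> x //= -[/andP[_ h1] /andP[h2 _]].
  by have := lt_le_trans h1 h2; rewrite ltxx.
congr (mu _); rewrite -addrA -natr1 addrA.
apply/seteqP; split=> x; rewrite /shell /=.
  move=> /andP[ax xk]; have [h|h] := ltP (height phi x) (a + k%:R).
    by left; rewrite ax.
  by right; rewrite xk.
have k0 : 0 <= k%:R :> R by [].
by move=> [|] /andP[h1 h2]; apply/andP; split; lra.
Qed.

Lemma shell_le a (k : nat) : 0 < a ->
  (mu (shell phi a (a + k%:R)) <=
    (k%:R * (2 * C * expR 1 / (1 + a)) ^+ n)%:E)%E.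
Proof.
move=> a0; elim: k => [|k IH].
  rewrite mul0r addr0 (_ : shell phi a a = set0) ?measure0//.
  by apply/seteqP; split=> x //= /andP[h1 h2]; have := le_lt_trans h1 h2; rewrite ltxx.
have ak : 0 < a + k%:R by rewrite ltr_wpDr.
have a1 : 0 < 1 + a by exact: addr_gt0.
have ak1 : 0 < 1 + (a + k%:R) by exact: addr_gt0.
rewrite shellS// -natr1 mulrDl mul1r EFinD leeD//.
apply: le_trans (unit_shell_le ak) _; rewrite lee_fin ler_pXn2r ?nnegrE//.
- rewrite ler_pM2l ?mulr_gt0 ?expR_gt0// lef_pV2 ?posrE//.
  by rewrite addrA lerDl.
- by rewrite divr_ge0 ?mulr_ge0 ?expR_ge0// ltW.
- by rewrite divr_ge0 ?mulr_ge0 ?expR_ge0// ltW.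
Qed.

Lemma shell_ge a b (k : nat) : 0 < a -> a + k%:R <= b ->
  ((k%:R * (2 * C * Num.sqrt n%:R * (2 + b)) ^- n)%:E <=
    mu (shell phi a (a + k%:R)))%E.
Proof.
move=> a0; have sn0 : 0 < Num.sqrt n%:R :> R by rewrite sqrtr_gt0 ltr0n.
elim: k => [|k IH] akb; first by rewrite mul0r.
have ak : 0 < a + k%:R by rewrite ltr_wpDr.
have akb' : a + k%:R <= b by apply: le_trans akb; rewrite lerD2l ler_nat.
rewrite shellS// -natr1 mulrDl mul1r EFinD leeD//; first exact: IH.
have Ks0 : 0 < 2 * C * Num.sqrt n%:R by rewrite !mulr_gt0.
have ak2 : 0 < 2 + (a + k%:R) by exact: addr_gt0.
have b2 : 0 < 2 + b by rewrite addr_gt0// (lt_le_trans ak).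
apply: le_trans (unit_shell_ge ak); rewrite lee_fin lef_pV2 ?posrE; last 2 first.
- by rewrite exprn_gt0// mulr_gt0.
- by rewrite exprn_gt0// mulr_gt0.
rewrite ler_pXn2r ?nnegrE ?mulr_ge0 ?(ltW ak2) ?(ltW b2) ?(ltW C0) ?sqrtr_ge0//.
by rewrite ler_pM2l// lerD2l.
Qed.

(** There are [4 * 2 ^ m] unit shells, each of volume at most a constant times
    [2 ^ (- m n)], whence the decay [2 ^ (- m (n - 1))]. *)
Lemma dyadic_shell_le (m : nat) :
  (mu (shell phi (4 * 2 ^+ m) (2 * (4 * 2 ^+ m))) <=
    ((2 * C * expR 1) ^+ n / (2 ^+ n.-1) ^+ m)%:E)%E.
Proof.
have X0 : 0 < 2 ^+ m :> R by rewrite exprn_gt0.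
have T0 : 0 < 4 * 2 ^+ m :> R by rewrite mulr_gt0.
have kE : (4 * 2 ^ m)%N%:R = 4 * 2 ^+ m :> R by rewrite natrM natrX.
have -> : 2 * (4 * 2 ^+ m) = 4 * 2 ^+ m + (4 * 2 ^ m)%N%:R :> R.
  by rewrite kE; ring.
apply: le_trans (shell_le _ T0) _; rewrite kE lee_fin [in leRHS]exprAC.
by apply: dyadic_upper; rewrite ?mulr_gt0 ?expR_gt0.
Qed.

(** The middle half of the dyadic shell, where the bump of index [m] is bounded
    below. *)
Lemma dyadic_shell_ge (m : nat) :
  ((2 / (9 * (2 * C * Num.sqrt n%:R)) ^+ n / (2 ^+ n.-1) ^+ m)%:E <=
    mu (shell phi (5 * 2 ^+ m) (7 * 2 ^+ m)))%E.
Proof.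
have X1 : 1 <= 2 ^+ m :> R by rewrite exprn_ege1// ler1n.
have T0 : 0 < 5 * 2 ^+ m :> R by rewrite mulr_gt0// (lt_le_trans ltr01).
have kE : (2 * 2 ^ m)%N%:R = 2 * 2 ^+ m :> R by rewrite natrM natrX.
have TE : 7 * 2 ^+ m = 5 * 2 ^+ m + (2 * 2 ^ m)%N%:R :> R.
  by rewrite kE; ring.
have Tle : 5 * 2 ^+ m + (2 * 2 ^ m)%N%:R <= 7 * 2 ^+ m :> R by rewrite TE.
have := shell_ge T0 Tle; rewrite -TE kE; apply: le_trans.
rewrite lee_fin [in leLHS]exprAC.
by apply: dyadic_lower; rewrite ?mulr_gt0 ?sqrtr_gt0 ?ltr0n.
Qed.

End CuspVolume.

(** * The bumps *)

Section Profile.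
Context {R : realType}.
Implicit Types (t : R).

(** A smooth function that is positive on [(1, 2)] and zero elsewhere. *)
Definition profile t : R := flat 0 (t - 1) * flat 0 (2 - t).

Definition profile' t : R :=
  flat 2 (t - 1) * flat 0 (2 - t) - flat 0 (t - 1) * flat 2 (2 - t).

Lemma profile_is_derive t : is_derive t 1 profile (profile' t).
Proof.
have d0 (s : R) : is_derive s 1 (flat 0) (flat 2 s).
  by have := flat_is_derive 0 s; rewrite mul0r subr0.
have d1 : is_derive t 1 (fun s : R => s - 1) 1.
  by apply: is_derive_eq; rewrite subr0.
have d2 : is_derive t 1 (fun s : R => 2 - s) (- 1).
  have := is_deriveB (is_derive_cst (2 : R) t 1) (is_derive_id t 1).
  by rewrite sub0r.
have c1 := is_derive1_comp (d0 _) d1; have c2 := is_derive1_comp (d0 _) d2.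
have -> : profile' t = (flat 0 \o (fun s => s - 1)) t *: (flat 2 (2 - t) * -1) +
    (flat 0 \o (fun s => 2 - s)) t *: (flat 2 (t - 1) * 1).
  by rewrite /profile' /GRing.scale /=; ring.
exact: is_deriveM c1 c2.
Qed.

Lemma profile_ge0 t : 0 <= profile t.
Proof. by rewrite mulr_ge0 ?flat_ge0. Qed.

Lemma profile_off t : ~~ (1 <= t < 2) -> profile t = 0 /\ profile' t = 0.
Proof.
rewrite negb_and -ltNge -leNgt /profile /profile' => /orP[t1|t2].
  have t1' : t - 1 <= 0 by lra.
  by rewrite !(flat_le0 _ t1') !mul0r subr0.
have t2' : 2 - t <= 0 by lra.
by rewrite !(flat_le0 _ t2') !mulr0 subr0.
Qed.

Let flat_bound (k : nat) (x c : R) : x <= 1 -> (k.+2)`!%:R = c ->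
  0 <= flat k x <= c.
Proof.
move=> x1 <-; rewrite flat_ge0 /=; have [x0|x0] := leP x 0.
  by rewrite flat_le0.
apply: le_trans (flat_le_sqr _ _) _.
by rewrite ler_piMr// expr_le1// ltW.
Qed.

(** On [(1, 2)] both arguments of the flat functions are at most [1], where
    [flat 0 <= 2] and [flat 2 <= 24]; and [2 * (2 * 24) = 96]. *)
Lemma profile_bounds t : `|profile t| <= 96 /\ `|profile' t| <= 96.
Proof.
have [/andP[t1 t2]|/profile_off[-> ->]] := boolP (1 <= t < 2); last first.
  by rewrite !normr0.
have t1' : t - 1 <= 1 by lra. have t2' : 2 - t <= 1 by lra.
have f2 : (2.+2)`!%:R = 24 :> R by [].
have f0 : (0.+2)`!%:R = 2 :> R by [].
have /andP[? ?] := flat_bound t1' f0; have /andP[? ?] := flat_bound t1' f2.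
have /andP[? ?] := flat_bound t2' f0; have /andP[? ?] := flat_bound t2' f2.
rewrite /profile /profile' !ler_norml; split; apply/andP; split; nra.
Qed.

Lemma profile_ge t : 5 / 4 <= t <= 7 / 4 -> expR (- 4) ^+ 2 <= profile t.
Proof.
move=> /andP[t1 t2].
have flat_ge (x : R) : 4^-1 <= x -> expR (- 4) <= flat 0 x.
  move=> x4; have x0 : 0 < x by apply: lt_le_trans x4; rewrite invr_gt0.
  rewrite /flat x0 expr0 mul1r ler_expR lerN2 -[leRHS]invrK.
  by rewrite lef_pV2 ?posrE ?invr_gt0.
by rewrite expr2 ler_pM ?expR_ge0// flat_ge//; lra.
Qed.

End Profile.

Definition level (R : realType) (m : nat) : R := 4 * 2 ^+ m.

(** In the coordinate [t = log (1 - log |x|)], in which the model metric is close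
    to that of a hyperbolic cusp, the bump of index [m] is supported in an
    interval of bounded length near [m log 2]. *)
Definition bump (R : realType) (M : topologicalType) (n : nat)
    (phi : chart R M n) (lam : R) (m : nat) (x : M) : R :=
  lam ^+ m * profile (height phi x / level R m).

Definition bumps (R : realType) (M : topologicalType) (n : nat)
    (phi : chart R M n) (lam : R) (N : nat) (x : M) : R :=
  \sum_(m < N) bump phi lam m x.

Definition bump_shell (R : realType) (M : topologicalType) (n : nat)
    (phi : chart R M n) (m : nat) : set M :=
  shell phi (level R m) (2 * level R m).

Section Bumps.
Context {R : realType} {M : ptopologicalType} {n : nat}.
Context {A : smooth_structure R M n} {phi : chart R M n} {p0 : M}.
Context (hM : hausdorff_space M) (Aphi : atlas A phi).
Context (phip0 : dom phi p0) (phi0 : coord phi p0 = 0).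
Context (ball1 : coord phi @` dom phi = [set y | enorm y < 1]).
Context {lam : R} (lam0 : 0 < lam).
Implicit Types (x : M) (m N : nat).

Lemma level_ge4 m : 4 <= level R m.
Proof. by rewrite ler_peMr// exprn_ege1// ler1n. Qed.

Lemma level_gt0 m : 0 < level R m.
Proof. exact: lt_le_trans (level_ge4 m). Qed.

Lemma level_ge m : m%:R <= level R m.
Proof.
apply: (@le_trans _ _ (2 ^+ m)); last by rewrite ler_peMl ?exprn_ge0// ler1n.
by rewrite -natrX ler_nat ltnW// ltn_expl.
Qed.

Lemma le_level m m' : (m <= m')%N -> level R m <= level R m'.
Proof. by move=> mm'; rewrite ler_pM2l// ler_weXn2l// ler1n. Qed.

Lemma bump_shellP m x : bump_shell phi m x <-> 1 <= height phi x / level R m < 2.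
Proof.
by rewrite ler_pdivlMr ?level_gt0// mul1r ltr_pdivrMr ?level_gt0.
Qed.

Lemma bump_shell_uniq m m' x :
  bump_shell phi m x -> bump_shell phi m' x -> m = m'.
Proof.
wlog mm' : m m' / (m < m')%N => [H Sm Sm'|].
  by have [h|h|//] := ltngtP m m'; [exact: H|exact/esym/H].
move=> /andP[_ h1] /andP[h2 _]; have := le_level mm'.
have -> : level R m.+1 = 2 * level R m by rewrite /level exprS mulrCA.
by move=> /(lt_le_trans (le_lt_trans h2 h1)); rewrite ltxx.
Qed.

Lemma profile_off_shell m x : ~ bump_shell phi m x ->
  profile (height phi x / level R m) = 0 /\
  profile' (height phi x / level R m) = 0.
Proof. by move=> Sx; apply: profile_off; apply/negP => /bump_shellP. Qed.

Lemma bump_off m x : ~ bump_shell phi m x -> bump phi lam m x = 0.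
Proof. by move=> /profile_off_shell[h _]; rewrite /bump h mulr0. Qed.

Lemma bump_ge0 m x : 0 <= bump phi lam m x.
Proof. by rewrite mulr_ge0 ?profile_ge0// exprn_ge0// ltW. Qed.

Lemma height_ge0 x : 0 <= height phi x.
Proof.
have [dx|ndx] := pselect (dom phi x); last first.
  by rewrite /height; case: asboolP.
have [->|xp] := eqVneq x p0.
  by rewrite /height; case: asboolP => // _; rewrite phi0 sqnorm0 ln0// oppr0 mul0r.
by have [/ltW] := height_cusp phip0 phi0 ball1 dx xp.
Qed.

(** Points with [height phi x <= 0] are those outside of the cusp and its tip; a
    closed slab separates them from the supports of finitely many bumps. *)
Lemma bump_eq0_near_core m x : height phi x <= 0 ->
  exists2 U, open_nbhs x U &
    forall z, U z -> forall m', (m' < m)%N -> bump phi lam m' z = 0.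
Proof.
move=> x0; exists (~` [set z | 4 <= height phi z <= 2 * level R m]).
  split; last by move=> /andP[/le_trans /(_ x0)]; rewrite leNgt ltr0n.
  by apply: closed_openC; apply: (closed_slab hM phip0 phi0 ball1).
move=> z Uz m' mm'; apply: bump_off => /andP[h1 /ltW h2]; apply: Uz.
rewrite /= (le_trans (level_ge4 m') h1) (le_trans h2)//.
by rewrite ler_pM2l// le_level// ltnW.
Qed.

(** In every chart of the atlas, the height is [- 1/2] times the logarithm of the
    sum of the squares of the components of a transition map. *)
Lemma bump_smooth m : smooth_function A (bump phi lam m).
Proof.
move=> c Ac k; apply: Ck_cover => _ [x [cx _] <-].
have [x0|x0] := ltP 0 (height phi x); last first.
  have [U [oU Ux] U0] := bump_eq0_near_core m.+1 x0.
  exists (img c U); first by exists x.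
  apply: Ck_eq (Ck_cst k _ 0); first exact: open_img.
  by move=> _ [z [cz Uz] <-] /=; rewrite coordK// U0.
pose U := [set z | 0 < height phi z].
have oU : open U by rewrite openE => z; exact: (near_height_gt0 hM phip0 phi0 ball1).
have oV : open (img c U) by exact: open_img.
exists (img c U); first by exists x.
pose f (y : 'rV[R]_n) := sqnorm (coord phi (icoord c y)).
have Cf : Ck k (img c U) f.
  apply: (@Ck_sum _ _ k _ _ (index_enum 'I_n)) => // i.
  have Ci : Ck k (img c U) (fun y => coord phi (icoord c y) 0 i).
    apply: Ck_sub (atlas_smooth Ac Aphi i k) => _ [z [cz Uz] <-].
    by exists z => //; split=> //; have [] := height_gt0 phi0 Uz.
  by under eq_fun do rewrite expr2; exact: CkM.
have f0 y : img c U y -> 0 < f y.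
  move=> [z [cz Uz] <-]; rewrite /f coordK//; have [dz zp] := height_gt0 phi0 Uz.
  by have [_ -> _] := height_cusp phip0 phi0 ball1 dz zp; rewrite exprn_gt0 ?expR_gt0.
pose h (y : 'rV[R]_n) := (- (2 * level R m)^-1) * ln (f y).
have Ch : Ck k (img c U) h := CkM oV (Ck_cst _ _ _) (Ck_ln oV f0 Cf).
have C1 : Ck k (img c U) (fun y => h y + -1) := CkD oV Ch (Ck_cst _ _ _).
have C2 : Ck k (img c U) (fun y => 2 + -1 * h y) :=
  CkD oV (Ck_cst _ _ _) (CkM oV (Ck_cst _ _ _) Ch).
have := CkM oV (Ck_cst k (img c U) (lam ^+ m))
  (CkM oV (Ck_flat 0 oV C1) (Ck_flat 0 oV C2)).
apply: Ck_eq oV _ => _ [z [cz Uz] <-] /=.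
have [dz zp] := height_gt0 phi0 Uz.
rewrite !fctE /h /f coordK// /bump /profile mulN1r.
suff -> : height phi z / level R m =
    - (2 * level R m)^-1 * ln (sqnorm (coord phi z)) by [].
rewrite /height; case: asboolP => // _; field.
by rewrite gt_eqF// level_gt0.
Qed.

Lemma bumps_smooth N : smooth_function A (bumps phi lam N).
Proof.
move=> c Ac k; have oV : open (img c setT) by apply: open_img; exact: openT.
apply: (@Ck_sum _ _ k _ _ (index_enum 'I_N)
  (fun (m : 'I_N) y => bump phi lam m (icoord c y))) => // m.
exact: bump_smooth.
Qed.

Lemma bumps_continuous N : continuous (bumps phi lam N).
Proof. exact: smooth_continuous (bumps_smooth N). Qed.

(** The sum of all bumps; at each point all but finitely many vanish. *)
Definition bumps_total x : R := bumps phi lam (Num.bound (height phi x)) x.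

Lemma bumps_stable N x : (Num.bound (height phi x) <= N)%N ->
  bumps phi lam N x = bumps_total x.
Proof.
rewrite /bumps_total => /subnKC <-.
elim: (N - _)%N => [|k IH]; first by rewrite addn0.
rewrite addnS {1}/bumps big_ord_recr /= -/(bumps phi lam _ x) IH.
rewrite bump_off ?addr0// => /andP[h _].
have := archi_boundP (height_ge0 x); rewrite ltNge => /negP; apply.
apply: le_trans h; apply: le_trans (level_ge _).
by rewrite ler_nat leq_addr.
Qed.

Lemma bumps_cvg x : bumps phi lam ^~ x @ \oo --> bumps_total x.
Proof.
apply: cvg_near_cst; near=> N; apply: bumps_stable.
by near: N; exact: nbhs_infty_ge.
Unshelve. all: by end_near. Qed.

Lemma bump_le_total m x : bump phi lam m x <= bumps_total x.
Proof.
rewrite -(bumps_stable (leq_maxl _ m.+1)) /bumps.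
have mN : (m < maxn (Num.bound (height phi x)) m.+1)%N by rewrite leq_max ltnSn orbT.
rewrite (bigD1 (Ordinal mN))//= lerDl.
by apply: sumr_ge0 => i _; exact: bump_ge0.
Qed.

Lemma bump_le_bumps m N x : (m < N)%N -> bump phi lam m x <= bumps phi lam N x.
Proof.
move=> mN; rewrite /bumps (bigD1 (Ordinal mN))//= lerDl.
by apply: sumr_ge0 => i _; exact: bump_ge0.
Qed.

End Bumps.

(** * Gradients of the bumps *)

(** The product of the factor [|x| (1 - log |x|)] and of the derivative of the
    bump in the direction of [- x / |x|]: up to sign, the length of its gradient
    in the model metric. *)
Definition slope (R : realType) (M : topologicalType) (n : nat)
    (phi : chart R M n) (lam : R) (m : nat) (x : M) : R :=
  lam ^+ m * profile' (height phi x / level R m) *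
    ((1 + height phi x) / level R m).

Section BumpGradient.
Context {R : realType} {M : ptopologicalType} {n : nat}.
Context {A : smooth_structure R M n} {W : set M} {w : tensor2 R M n}.
Context {phi : chart R M n} {p0 : M} {C : R}.
Context (hM : hausdorff_space M) (C1 : 1 <= C) (Aphi : atlas A phi).
Context (phip0 : dom phi p0) (phi0 : coord phi p0 = 0).
Context (ball1 : coord phi @` dom phi = [set y | enorm y < 1]).
Context (rw : riemannian_metric A W w).
Context (WP : forall x, dom phi x -> x != p0 -> W x).
Context (w_bounds : forall x v, dom phi x -> x != p0 ->
  C^-1 * (cusp_scale phi x ^- 2 * sqnorm v) <= qform (w phi x) v
    <= C * (cusp_scale phi x ^- 2 * sqnorm v)).
Context {lam : R} (lam0 : 0 < lam).
Implicit Types (x : M) (m N K : nat) (e : nat -> R).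

Let C0 : 0 < C := lt_le_trans ltr01 C1.

(** Besides the partial sums of the bumps, this covers their differences. *)
Definition comb e K x : R := \sum_(m < K) e m * bump phi lam m x.

(** The combination is a function [H] of [sqnorm] in the coordinates of the cusp.
    The factor [C * (cusp_scale phi x) ^ 2] bounds the inverse of the metric, and
    [4 * sqnorm] is the squared length of the derivative of [sqnorm]. *)
Lemma comb_gradient e K x : 0 < height phi x ->
  gradient_norm A w (comb e K) x ^+ 2 <=
    C * (\sum_(m < K) e m * slope phi lam m x) ^+ 2.
Proof.
move=> hx; have [dx xp] := height_gt0 phi0 hx.
have [_ sE _] := height_cusp phip0 phi0 ball1 dx xp.
set y := coord phi x; set h := height phi x; set r := expR (- h) in sE.
have r0 : 0 < r := expR_gt0 _.
have h1 : 0 < 1 + h by rewrite addr_gt0.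
have s0 : 0 < cusp_scale phi x := cusp_scale_gt0 phip0 phi0 ball1 dx xp.
pose c m : R := - (2 * level R m)^-1.
have cE z m : dom phi z -> c m * ln (sqnorm (coord phi z)) = height phi z / level R m.
  rewrite /c /height; case: asboolP => // _ _; field.
  by rewrite gt_eqF// level_gt0.
pose g m (t : R) := c m * ln t.
pose H (t : R) := \sum_(m < K) e m * (lam ^+ m * profile (g m t)).
pose dH := \sum_(m < K)
  e m * (lam ^+ m * (profile' (h / level R m) * (c m * (r ^+ 2)^-1))).
have y0 : 0 < sqnorm y by rewrite sE exprn_gt0.
have HD : is_derive (sqnorm y) 1 H dH.
  have Dm (m : 'I_K) : is_derive (sqnorm y) 1
      ((e m * lam ^+ m) *: (profile \o g m))
      ((e m * lam ^+ m) *: (profile' (g m (sqnorm y)) * (c m *: (sqnorm y)^-1))).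
    have gD : is_derive (sqnorm y) 1 (g m) (c m *: (sqnorm y)^-1).
      exact: is_deriveZ (is_derive1_ln y0).
    exact: is_deriveZ (is_derive1_comp (profile_is_derive _) gD).
  have := is_derive_sum Dm.
  have -> : \sum_(m < K) (e m * lam ^+ m) *: (profile \o g m) = H.
    apply/funext => t; rewrite fct_sumE; apply: eq_bigr => m _.
    by rewrite fctE /GRing.scale /= mulrA.
  have -> // : \sum_(m < K) (e m * lam ^+ m) *:
      (profile' (g m (sqnorm y)) * (c m *: (sqnorm y)^-1)) = dH.
  apply: eq_bigr => m _; rewrite /GRing.scale /= /g cE// -/h sE.
  by rewrite !mulrA.
have near_H : {near y, H \o sqnorm =1 comb e K \o icoord phi}.
  have := near_icoord dx (near_height_gt0 hM phip0 phi0 ball1 hx).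
  have : nbhs y (coord phi @` dom phi).
    by apply: open_nbhs_nbhs; split; [exact: img_open|exists x].
  apply: filterS2 => _ [z dz <-]; rewrite /= coordK// => hz.
  by apply: eq_bigr => m _; rewrite /bump /g cE.
have [dHs _] := is_derive_chain 0 (differentiable_sqnorm y) HD.
have kw v : (v *m v^T) 0 0 <= C * cusp_scale phi x ^+ 2 * qform (w phi x) v.
  have /andP[+ _] := w_bounds v dx xp; rewrite -sqnormE mulrCA.
  by rewrite ler_pdivrMl ?exprn_gt0// ler_pdivrMl// mulrA.
have := gradient_norm_le rw Aphi dx (WP dx xp)
  (near_eq_differentiable near_H dHs) _ kw.
rewrite mulr_gt0 ?exprn_gt0// => /(_ isT) /le_trans; apply.
have -> : \sum_(j < n) 'D_(delta_mx 0 j) (comb e K \o icoord phi) y ^+ 2 =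
    dH ^+ 2 * 4 * sqnorm y.
  rewrite /sqnorm mulr_sumr; apply: eq_bigr => j _.
  rewrite -(near_eq_derive _ near_H).
  have [_ ->] := is_derive_chain (delta_mx 0 j) (differentiable_sqnorm y) HD.
  by rewrite derive_sqnorm; ring.
have -> : dH = - (2 * r ^+ 2 * (1 + h))^-1 * \sum_(m < K) e m * slope phi lam m x.
  rewrite /dH mulr_sumr; apply: eq_bigr => m _; rewrite /slope /c -/h.
  by field; rewrite !gt_eqF ?level_gt0.
rewrite sE /cusp_scale -/h -/r le_eqVlt; apply/orP; left; apply/eqP.
by field; rewrite !gt_eqF.
Qed.

Lemma comb_gradient0 e K x : height phi x <= 0 ->
  gradient_norm A w (comb e K) x = 0.
Proof.
move=> x0; apply: gradient_norm_eq0.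
have [U oU U0] := bump_eq0_near_core hM phip0 phi0 ball1 K (lam := lam) x0.
have : nbhs x U by exact: open_nbhs_nbhs.
by apply: filterS => z Uz; rewrite /comb big1 // => m _; rewrite U0// mulr0.
Qed.

(** A common bound for the bump and for [C] times its slope: [96] bounds the
    profile and its derivative, and [3] bounds [(1 + height) / level] on the
    shell. *)
Definition peak m : R := 288 * C * lam ^+ m.

Lemma peak_ge0 m : 0 <= peak m.
Proof.
apply: mulr_ge0; last by rewrite exprn_ge0// ltW.
by apply: mulr_ge0; [exact: ler0n|exact: ltW].
Qed.

Lemma bump_le_peak m x : `|bump phi lam m x| <= peak m.
Proof.
rewrite normrM ger0_norm ?exprn_ge0 ?(ltW lam0)// mulrC.
apply: ler_pM => //; first by rewrite exprn_ge0 ?ltW.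
have [h _] := profile_bounds (height phi x / level R m).
by rewrite (le_trans h)//; have := C1; lra.
Qed.

Lemma slope_le_peak m x : C * `|slope phi lam m x| <= peak m.
Proof.
have [Sx|Sx] := pselect (bump_shell phi m x); last first.
  have [_ p0'] := profile_off_shell Sx.
  by rewrite /slope p0' mulr0 mul0r normr0 mulr0 peak_ge0.
have L4 := level_ge4 (R := R) m; have L0 := level_gt0 (R := R) m.
have /andP[hL h2L] := Sx.
have le3 : (1 + height phi x) / level R m <= 3 by rewrite ler_pdivrMr//; lra.
have ge0 : 0 <= (1 + height phi x) / level R m by rewrite divr_ge0//; lra.
rewrite /slope normrM (ger0_norm ge0) normrM (ger0_norm (exprn_ge0 _ (ltW lam0))).
have [_ h'] := profile_bounds (height phi x / level R m).
rewrite /peak (_ : 288 * C * lam ^+ m = C * (lam ^+ m * 96 * 3)); last by ring.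
rewrite ler_pM2l//; apply: ler_pM => //.
  by rewrite mulr_ge0 ?normr_ge0// exprn_ge0// ltW.
by rewrite ler_pM2l// exprn_gt0.
Qed.

(** Bounds the squares of the sum of the bumps of index
    at least [N] and of the length of its gradient. *)
Definition tail N x : \bar R :=
  (\sum_(0 <= m <oo)
    (peak (N + m) ^+ 2 * \1_(bump_shell phi (N + m)) x)%:E)%E.

Lemma tail_ge0 N x : (0 <= tail N x)%E.
Proof.
by apply: nneseries_ge0 => m _ _; rewrite lee_fin mulr_ge0 ?sqr_ge0.
Qed.

(** The shells are disjoint, so at most one term of each sum is not zero, and
    squaring commutes with summation. *)
Lemma sum_le_tail (F : nat -> R) e K N x :
  (forall m, ~ bump_shell phi m x -> F m = 0) ->
  (forall m, `|F m| <= peak m) ->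
  (forall m, `|e m| <= 1) -> (forall m, (m < N)%N -> e m = 0) ->
  (((\sum_(m < K) e m * F m) ^+ 2)%:E <= tail N x)%E.
Proof.
move=> F0 FP e1 e0.
have [[m Sm]|noS] := pselect (exists m, bump_shell phi m x); last first.
  rewrite big1 => [|m _]; last by rewrite F0 ?mulr0// => Sm; apply: noS; exists m.
  by rewrite expr0n /=; exact: tail_ge0.
have F0' m' : m' != m -> F m' = 0.
  move=> m'm; apply: F0 => Sm'.
  by move: m'm; rewrite (bump_shell_uniq Sm' Sm) eqxx.
have sumE : \sum_(i < K) e i * F i = if (m < K)%N then e m * F m else 0.
  case: ifP => mK.
    rewrite (bigD1 (Ordinal mK))//= big1 ?addr0// => i im.
    by rewrite F0' ?mulr0.
  rewrite big1// => i _; rewrite F0' ?mulr0//.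
  by apply: contraFneq mK => <-.
rewrite sumE; case: ifP => _; last by rewrite expr0n /=; exact: tail_ge0.
have [mN|Nm] := ltnP m N.
  by rewrite e0// mul0r expr0n /=; exact: tail_ge0.
apply: (@le_trans _ _ (peak m ^+ 2 * \1_(bump_shell phi m) x)%:E).
  rewrite indicE mem_set// mulr1 lee_fin -[leLHS]real_normK ?num_real//.
  rewrite lerXn2r ?nnegrE ?peak_ge0// normrM.
  by apply: le_trans (FP m); rewrite ler_piMl.
rewrite -{1 2}(subnKC Nm).
have t0 k : (0 <= k)%N -> true ->
    (0 <= (peak (N + k) ^+ 2 * \1_(bump_shell phi (N + k)) x)%:E)%E.
  by move=> _ _; rewrite lee_fin mulr_ge0 ?sqr_ge0.
have := nneseries_lim_ge (m - N).+1 t0; apply: le_trans.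
rewrite big_nat_recr//= leeDr// sume_ge0// => k _.
by rewrite lee_fin mulr_ge0 ?sqr_ge0.
Qed.

Lemma bumpsB i j : bumps phi lam i \- bumps phi lam j =
  comb (fun m => (m < i)%N%:R - (m < j)%N%:R) (maxn i j).
Proof.
have E k K : (k <= K)%N ->
    (fun x => \sum_(m < K) (m < k)%N%:R * bump phi lam m x) = bumps phi lam k.
  move=> kK; apply/funext => x.
  rewrite /bumps (big_ord_widen K (fun m => bump phi lam m x) kK).
  by rewrite [RHS]big_mkcond/=; apply: eq_bigr => m _; case: ifP; rewrite ?mul1r ?mul0r.
apply/funext => x; rewrite /= -(E i _ (leq_maxl i j)) -(E j _ (leq_maxr i j)).
by rewrite -sumrB; apply: eq_bigr => m _; rewrite mulrBl.
Qed.

Let diff_coef i j m : `|(m < i)%N%:R - (m < j)%N%:R : R| <= 1.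
Proof.
by case: (m < i)%N; case: (m < j)%N; rewrite ?subrr ?subr0 ?sub0r ?normrN ?normr1 ?normr0.
Qed.

Let diff_coef0 N i j : (N <= i)%N -> (N <= j)%N ->
  forall m, (m < N)%N -> (m < i)%N%:R - (m < j)%N%:R = 0 :> R.
Proof.
by move=> Ni Nj m mN; rewrite (leq_trans mN Ni) (leq_trans mN Nj) subrr.
Qed.

Lemma bumps_diff_tail N i j x : (N <= i)%N -> (N <= j)%N ->
  (((bumps phi lam i \- bumps phi lam j) x ^+ 2)%:E <= tail N x)%E.
Proof.
move=> Ni Nj; rewrite bumpsB; apply: (sum_le_tail (F := bump phi lam ^~ x)) => //.
- by move=> m; exact: bump_off.
- by move=> m; exact: bump_le_peak.
- exact: diff_coef0.
Qed.

Lemma gradient_diff_tail N i j x : (N <= i)%N -> (N <= j)%N ->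
  ((gradient_norm A w (bumps phi lam i \- bumps phi lam j) x ^+ 2)%:E
    <= tail N x)%E.
Proof.
move=> Ni Nj; rewrite bumpsB; set e := fun m => _.
have [x0|x0] := leP (height phi x) 0.
  by rewrite comb_gradient0// expr0n /=; exact: tail_ge0.
apply: (@le_trans _ _
    ((\sum_(m < maxn i j) e m * (C * slope phi lam m x)) ^+ 2)%:E).
  rewrite lee_fin; apply: le_trans (comb_gradient _ _ x0) _.
  under [in leRHS]eq_bigr do rewrite mulrCA.
  rewrite -mulr_sumr exprMn ler_wpM2r ?sqr_ge0//.
  by rewrite expr2 ler_peMr// ltW.
apply: (sum_le_tail (F := fun m => C * slope phi lam m x)) => //.
- by move=> m /profile_off_shell[_ h]; rewrite /slope h mulr0 mul0r mulr0.
- by move=> m; rewrite normrM (ger0_norm (ltW C0)); exact: slope_le_peak.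
- exact: diff_coef.
- exact: diff_coef0.
Qed.

Lemma bumps_total_tail N j x : (N <= j)%N ->
  (((bumps phi lam j x - bumps_total (phi := phi) (lam := lam) x) ^+ 2)%:E
    <= tail N x)%E.
Proof.
move=> Nj; set K := maxn N (Num.bound (height phi x)).
rewrite -(bumps_stable phip0 phi0 ball1 (leq_maxr N _ : (_ <= K)%N)).
by apply: bumps_diff_tail => //; exact: leq_maxl.
Qed.

End BumpGradient.

(** * Integration over the cusp *)

Lemma geometric_sum_le (R : realType) (z : R) (k : nat) : 0 <= z < 1 ->
  \sum_(0 <= m < k) z ^+ m <= (1 - z)^-1.
Proof.
move=> /andP[z0 z1]; have z1' : 0 < 1 - z by rewrite subr_gt0.
rewrite -[leRHS]mul1r ler_pdivlMr//.
suff -> : (\sum_(0 <= m < k) z ^+ m) * (1 - z) = 1 - z ^+ k.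
  by rewrite gerBl exprn_ge0.
elim: k => [|k IH]; first by rewrite big_nil mul0r expr0 subrr.
by rewrite big_nat_recr//= mulrDl IH exprSr; ring.
Qed.

Lemma bernoulli_le (R : realType) (z : R) (k : nat) : 1 <= z ->
  1 + k%:R * (z - 1) <= z ^+ k.
Proof.
move=> z1; elim: k => [|k IH]; first by rewrite mul0r addr0 expr0.
rewrite exprS -natr1; apply: le_trans (ler_wpM2l _ IH); last first.
  exact: le_trans z1.
rewrite -subr_ge0.
have -> : z * (1 + k%:R * (z - 1)) - (1 + (k%:R + 1) * (z - 1)) =
    k%:R * (z - 1) ^+ 2 by ring.
by rewrite mulr_ge0 ?sqr_ge0.
Qed.

Lemma continuous_borel (R : realType) (M : ptopologicalType) (f : M -> R) :
  continuous f -> measurable_fun setT (f : borel M -> R).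
Proof.
move=> cf; apply: (measurability (@RGenOpens.G R)).
  exact: RGenOpens.measurableE.
move=> _ [_ [a [b ->]] <-]; rewrite setTI.
apply: sub_sigma_algebra; move/continuousP : cf; apply.
exact: interval_open.
Qed.

(** Only the monotonicity of the integral is used, so that the lemma applies to the
    norm of a gradient, computed in unspecified charts. *)
Lemma Lp2_norm_le (R : realType) (M : ptopologicalType) (W : set M)
    (mu : {measure set (borel M) -> \bar R}) (v : M -> R) (f : M -> \bar R)
    (c : R) :
  (forall x, W x -> ((v x ^+ 2)%:E <= f x)%E) -> 0 <= c ->
  (\int[mu]_(x in W) f x <= c%:E)%E ->
  (Lp_norm W mu 2 v <= (Num.sqrt c)%:E)%E.
Proof.
move=> vf c0 fc; rewrite /Lp_norm -powR12_sqrt// -poweR_EFin.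
have vE x : `|v x| `^ 2 = v x ^+ 2.
  by rewrite powR_mulrn// real_normK ?num_real.
have I0 : (0 <= \int[mu]_(x in W) (`|v x| `^ 2)%:E)%E.
  by apply: integral_ge0 => x _; rewrite lee_fin powR_ge0.
have Ic : (\int[mu]_(x in W) (`|v x| `^ 2)%:E <= c%:E)%E.
  apply: le_trans fc; apply: ge0_le_integral_nonmeas => x Wx.
    by rewrite lee_fin powR_ge0.
  by rewrite vE; exact: vf.
by apply: gt0_ler_poweR => //; rewrite ?in_itv /= ?leey ?andbT ?lee_fin//.
Qed.

Section CuspSobolev.
Context {R : realType} {M : ptopologicalType} {n : nat}.
Context {A : smooth_structure R M n} {W : set M} {w : tensor2 R M n}.
Context {mu : {measure set (borel M) -> \bar R}}.
Context {phi : chart R M n} {p0 : M} {C : R}.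
Context (hM : hausdorff_space M) (n0 : (0 < n)%N) (C1 : 1 <= C).
Context (Aphi : atlas A phi).
Context (phip0 : dom phi p0) (phi0 : coord phi p0 = 0).
Context (ball1 : coord phi @` dom phi = [set y | enorm y < 1]).
Context (mW : measurable (W : set (borel M))).
Context (WP : forall x, dom phi x -> x != p0 -> W x).
Context (rw : riemannian_metric A W w).
Context (w_bounds : forall x v, dom phi x -> x != p0 ->
  C^-1 * (cusp_scale phi x ^- 2 * sqnorm v) <= qform (w phi x) v
    <= C * (cusp_scale phi x ^- 2 * sqnorm v)).
Context (vol : volume_element A W w mu).
Context {lam q : R} (lam0 : 0 < lam) (q0 : 0 < q).
Context (lam2 : lam ^+ 2 < 2 ^+ n.-1) (lamq : 2 ^+ n.-1 < lam `^ q).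
Implicit Types (x : M) (m N : nat) (v : M -> R).

Local Notation bumps := (bumps phi lam).
Local Notation total := (bumps_total (phi := phi) (lam := lam)).
Local Notation tail := (tail (phi := phi) (C := C) (lam := lam)).

Let C0 : 0 < C := lt_le_trans ltr01 C1.

Let b : R := 2 ^+ n.-1.

Let b0 : 0 < b. Proof. by rewrite exprn_gt0. Qed.

Let w_sym x : dom phi x -> x != p0 -> (w phi x)^T = w phi x.
Proof. by move=> dx xp; apply: (metric_sym rw) => //; exact: WP. Qed.

(* The ratio at which the squared norms of the bumps in H^1 decrease. *)
Let rho : R := lam ^+ 2 / b.

Let rho01 : 0 <= rho < 1.
Proof. by rewrite divr_ge0 ?sqr_ge0 ?(ltW b0)//= ltr_pdivrMr// mul1r. Qed.

Let total_mass : R := (288 * C) ^+ 2 * (2 * C * expR 1) ^+ n / (1 - rho).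

Let total_mass_ge0 : 0 <= total_mass.
Proof.
have /andP[_ r1] := rho01.
apply: divr_ge0; last by rewrite subr_ge0 ltW.
apply: mulr_ge0; first exact: sqr_ge0.
by rewrite exprn_ge0// !mulr_ge0 ?expR_ge0 ?(ltW C0).
Qed.

Lemma measurable_bump_shell m : measurable (bump_shell phi m : set (borel M)).
Proof.
by apply: (measurable_shell hM phip0 phi0 ball1); exact: level_gt0.
Qed.

Lemma tail_integral N :
  (\int[mu]_(x in W) tail N x <= (total_mass * rho ^+ N)%:E)%E.
Proof.
have mind m : measurable_fun (W : set (borel M))
    (fun x : borel M => (\1_(bump_shell phi m) x)%:E : \bar R).
  apply/measurable_EFinP; apply: measurable_funTS; apply: measurable_indic.
  exact: measurable_bump_shell.
have term_le m : (\int[mu]_(x in W)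
    ((peak (C := C) (lam := lam) m ^+ 2 * \1_(bump_shell phi m) x)%:E) <=
    ((288 * C) ^+ 2 * (2 * C * expR 1) ^+ n * rho ^+ m)%:E)%E.
  under eq_integral do rewrite EFinM.
  rewrite ge0_integralZl//=; last by rewrite lee_fin sqr_ge0.
  rewrite integral_indic//; last exact: measurable_bump_shell.
  have muS := dyadic_shell_le hM n0 C1 Aphi phip0 phi0 ball1 WP w_sym w_bounds vol m.
  apply: (@le_trans _ _ ((peak (C := C) (lam := lam) m ^+ 2)%:E *
      ((2 * C * expR 1) ^+ n / b ^+ m)%:E)%E).
    apply: lee_pmul => //; first by rewrite lee_fin sqr_ge0.
    apply: le_trans muS; apply: le_measure; rewrite ?inE//.
      by apply: measurableI => //; exact: measurable_bump_shell.
    exact: measurable_bump_shell.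
  rewrite -EFinM lee_fin le_eqVlt; apply/orP; left; apply/eqP.
  have -> : rho ^+ m = (lam ^+ m) ^+ 2 / b ^+ m by rewrite /rho expr_div_n exprAC.
  rewrite /peak (exprMn _ (288 * C)).
  move: (288 * C) ((2 * C * expR 1) ^+ n) (lam ^+ m) (b ^+ m) => c1 Q l B.
  by ring.
rewrite /tail integral_nneseries//; last 2 first.
- by move=> m; under eq_fun do rewrite EFinM; exact: measurable_funeM.
- by move=> m x _; rewrite lee_fin mulr_ge0 ?sqr_ge0.
apply: lime_le.
  apply: is_cvg_nneseries => m _ _; apply: integral_ge0 => x _.
  by rewrite lee_fin mulr_ge0 ?sqr_ge0.
apply: nearW => k; apply: le_trans (lee_sum _ (fun m _ => term_le (N + m)%N)) _.
rewrite sumEFin lee_fin.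
under eq_bigr do rewrite exprD mulrA.
rewrite -mulr_sumr /total_mass mulrAC; have /andP[r0 _] := rho01.
apply: ler_wpM2r; first exact: exprn_ge0.
apply: ler_wpM2l; last exact: geometric_sum_le.
by rewrite mulr_ge0 ?sqr_ge0// exprn_ge0// !mulr_ge0 ?expR_ge0 ?(ltW C0).
Qed.

Let bound N : R := Num.sqrt (total_mass * rho ^+ N).

Let bound_cvg0 : bound @ \oo --> 0.
Proof.
rewrite -[X in _ --> X]sqrtr0; apply: continuous_cvg; first exact: sqrt_continuous.
rewrite -[X in _ --> X](mulr0 total_mass); apply: cvgMr; apply: cvg_expr.
by have /andP[r0 r1] := rho01; rewrite ger0_norm.
Qed.

Let Lp2_tail N v : (forall x, W x -> ((v x ^+ 2)%:E <= tail N x)%E) ->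
  (Lp_norm W mu 2 v <= (bound N)%:E)%E.
Proof.
move=> vt; apply: (Lp2_norm_le vt); last exact: tail_integral.
by rewrite mulr_ge0// exprn_ge0//; case/andP: rho01.
Qed.

Lemma bumps_H1_diff N i j : (N <= i)%N -> (N <= j)%N ->
  (H1_norm A W w mu (bumps i \- bumps j)%R <= (bound N + bound N)%:E)%E.
Proof.
move=> Ni Nj; rewrite /H1_norm EFinD leeD//; apply: Lp2_tail => x Wx.
  exact: (gradient_diff_tail hM C1 Aphi phip0 phi0 ball1 rw WP w_bounds).
exact: bumps_diff_tail.
Qed.

Lemma measurable_total :
  measurable_fun (W : set (borel M)) (total : borel M -> R).
Proof.
apply: measurable_funTS.
apply: (@measurable_fun_cvg _ _ _ _ (fun N => bumps N : borel M -> R)) => //.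
  move=> N; apply: continuous_borel.
  exact: (bumps_continuous hM Aphi phip0 phi0 ball1).
by move=> x _; exact: (bumps_cvg phip0 phi0 ball1).
Qed.

Lemma total_H1 : in_H1 A W w mu total.
Proof.
exists (fun N => bumps N); split.
- exact: (bumps_smooth hM Aphi phip0 phi0 ball1).
- move=> e e0; have /cvgr0Pnorm_lt/(_ (e / 2)) := bound_cvg0.
  rewrite divr_gt0// => /(_ isT)[N _ HN]; exists N => i j Ni Nj.
  apply: le_lt_trans (bumps_H1_diff Ni Nj) _; rewrite lte_fin.
  have := HN N (leqnn N); rewrite /= ger0_norm ?sqrtr_ge0//; lra.
- exact: measurable_total.
- apply: (@squeeze_cvge _ _ _ _ (cst 0%E) _ (EFin \o bound)).
  + apply: nearW => j; rewrite poweR_ge0 /=; apply: Lp2_tail => x Wx.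
    by apply: (bumps_total_tail C1 phip0 phi0 ball1).
  + exact: cvg_cst.
  + apply: cvg_EFin; first exact: nearW.
    exact: bound_cvg0.
Qed.

(* The rate at which the integrals of the q-th powers of the bumps grow. *)
Let theta : R := lam `^ q / b.

Let theta1 : 1 < theta. Proof. by rewrite ltr_pdivlMr// mul1r. Qed.

Let mass : R := (expR (- 4) ^+ 2) `^ q * (2 / (9 * (2 * C * Num.sqrt n%:R)) ^+ n).

Let mass_gt0 : 0 < mass.
Proof.
rewrite mulr_gt0 ?powR_gt0 ?exprn_gt0 ?expR_gt0// divr_gt0// exprn_gt0//.
by rewrite !mulr_gt0// sqrtr_gt0 ltr0n.
Qed.

Lemma theta_unbounded (B : R) : exists m, B < mass * theta ^+ m.
Proof.
have t0 : 0 < theta - 1 by rewrite subr_gt0.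
have mt0 : 0 < mass * (theta - 1) by exact: mulr_gt0.
pose k := Num.bound (`|B| / (mass * (theta - 1))); exists k.
have kB : `|B| < k%:R * (mass * (theta - 1)).
  by rewrite -ltr_pdivrMr//; apply: archi_boundP; rewrite divr_ge0// ltW.
apply: le_lt_trans (ler_norm B) _; apply: lt_le_trans kB _.
rewrite mulrCA ler_pM2l//; apply: le_trans (bernoulli_le k (ltW theta1)).
by rewrite lerDr.
Qed.

(** On the middle half of its shell the bump is at least [lam ^ m * exp(-8)], and
    the volume of that half is at least a constant times [2 ^ (- m (n - 1))]. *)
Lemma Lq_integral_ge m v : (forall x, bump phi lam m x <= v x) ->
  ((mass * theta ^+ m)%:E <= \int[mu]_(x in W) (`|v x| `^ q)%:E)%E.
Proof.
move=> bv; pose K : set (borel M) := shell phi (5 * 2 ^+ m) (7 * 2 ^+ m).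
have X0 : 0 < 2 ^+ m :> R by rewrite exprn_gt0.
have a0 : 0 < 5 * 2 ^+ m :> R by exact: mulr_gt0.
have KW : K `<=` W by move=> x /(shell_cusp phi0 a0)[]; exact: WP.
have mK : measurable K by exact: (measurable_shell hM phip0 phi0 ball1).
pose c : R := (lam ^+ m * expR (- 4) ^+ 2) `^ q.
have c0 : 0 <= c by exact: powR_ge0.
apply: (@le_trans _ _ (\int[mu]_(x in W) (c%:E * (\1_K x)%:E))%E); last first.
  apply: ge0_le_integral_nonmeas => x Wx; rewrite -EFinM lee_fin.
    by rewrite mulr_ge0.
  rewrite indicE; have [|_] := boolP (x \in K); last by rewrite mulr0 powR_ge0.
  rewrite inE mulr1 => /andP[h5 h7].
  have le_v : lam ^+ m * expR (- 4) ^+ 2 <= `|v x|.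
    apply: le_trans (ler_norm _); apply: le_trans (bv x).
    rewrite ler_pM2l ?exprn_gt0//; apply: profile_ge.
    rewrite /level ler_pdivlMr ?mulr_gt0// ler_pdivrMr ?mulr_gt0//.
    by apply/andP; split; lra.
  apply: ge0_ler_powR; rewrite ?nnegrE ?(ltW q0)//.
  by rewrite mulr_ge0 ?exprn_ge0 ?expR_ge0 ?(ltW lam0).
rewrite ge0_integralZl//; last first.
  by apply/measurable_EFinP; apply: measurable_funTS; exact: measurable_indic.
rewrite integral_indic// setIidl//.
have muK := dyadic_shell_ge hM n0 C1 Aphi phip0 phi0 ball1 WP w_sym w_bounds vol m.
apply: le_trans (lee_wpmul2l _ muK); last by rewrite lee_fin.
rewrite -EFinM lee_fin le_eqVlt; apply/orP; left; apply/eqP.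
have cE : c = (lam `^ q) ^+ m * (expR (- 4) ^+ 2) `^ q.
  rewrite /c powRM ?exprn_ge0 ?expR_ge0 ?(ltW lam0)//; congr (_ * _).
  by rewrite -(powR_mulrn m (powR_ge0 lam q)) -(powR_mulrn m (ltW lam0)) powRAC.
rewrite cE /mass /theta expr_div_n -/b.
move: (_ `^ q) (2 / _) (_ ^+ m) (b ^+ m) => x1 x2 x3 x4.
by ring.
Qed.

Lemma total_not_Lq : ~ in_Lp W mu q total.
Proof.
move=> [_]; rewrite /Lp_norm => /lty_poweRy.
rewrite invr_eq0 gt_eqF// => /(_ isT) Ioo.
have I0 : (0 <= \int[mu]_(x in W) (`|total x| `^ q)%:E)%E.
  by apply: integral_ge0 => x _; rewrite lee_fin powR_ge0.
have [m] := theta_unbounded (fine (\int[mu]_(x in W) (`|total x| `^ q)%:E)).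
rewrite ltNge => /negP; apply; rewrite -lee_fin fineK ?ge0_fin_numE//.
apply: Lq_integral_ge => x.
exact: (bump_le_total phip0 phi0 ball1 lam0).
Qed.

Lemma H1_norm0 : H1_norm A W w mu (fun=> 0) = 0%E.
Proof.
rewrite /H1_norm /Lp_norm !integral0_eq ?poweR0r ?adde0// => x _.
  by rewrite normr0 powR0.
by rewrite gradient_norm_eq0 ?normr0 ?powR0//; exact: nearW.
Qed.

Lemma Lp2_norm0 : Lp_norm W mu 2 (fun=> 0) = 0%E.
Proof.
by rewrite /Lp_norm !integral0_eq ?poweR0r// => x _; rewrite normr0 powR0.
Qed.

Lemma bumps_H1_le N : (H1_norm A W w mu (bumps N) <= (bound 0 + bound 0)%:E)%E.
Proof.
have -> : bumps N = (bumps N \- bumps 0)%R.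
  have b0E x : bumps 0 x = 0 by exact: big_ord0.
  by apply/funext => x; rewrite /= b0E subr0.
exact: bumps_H1_diff.
Qed.

Lemma bumps_has_H1_norm N :
  has_H1_norm A W w mu (bumps N) (fine (H1_norm A W w mu (bumps N))).
Proof.
have subE : (bumps N \- bumps N)%R = fun=> 0.
  by apply/funext => x /=; rewrite subrr.
exists (fun=> bumps N); split; last first.
  rewrite fineK; first exact: cvg_cst.
  rewrite ge0_fin_numE; last by rewrite adde_ge0 ?poweR_ge0.
  exact: le_lt_trans (bumps_H1_le N) (ltry _).
split.
- by move=> _; exact: (bumps_smooth hM Aphi phip0 phi0 ball1).
- by move=> e e0; exists 0%N => i j _ _; rewrite subE H1_norm0.
- apply: measurable_funTS; apply: continuous_borel.
  exact: (bumps_continuous hM Aphi phip0 phi0 ball1).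
- by rewrite subE Lp2_norm0; exact: cvg_cst.
Qed.

(** The norms of the partial sums in H^1 stay bounded, by the integral of
    [tail 0], while their q-norms do not. *)
Lemma no_sobolev : ~ (exists C' : R, forall (v : M -> R) (N : R),
  has_H1_norm A W w mu v N -> (Lp_norm W mu q v <= (C' * N)%:E)%E).
Proof.
move=> [C' sob]; pose P := `|C'| * (bound 0 + bound 0).
have [m] := theta_unbounded (P `^ q).
rewrite ltNge => /negP; apply; rewrite -lee_fin.
have bv x : bump phi lam m x <= bumps m.+1 x by exact: bump_le_bumps.
apply: le_trans (Lq_integral_ge bv) _.
set I := (\int[mu]_(x in W) _)%E.
have I0 : (0 <= I)%E.
  by apply: integral_ge0 => x _; rewrite lee_fin powR_ge0.
have LP : (I `^ q^-1 <= P%:E)%E.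
  apply: le_trans (sob _ _ (bumps_has_H1_norm m.+1)) _; rewrite lee_fin.
  apply: le_trans (ler_norm _) _; rewrite normrM ler_wpM2l//.
  rewrite ger0_norm; last by rewrite fine_ge0// adde_ge0 ?poweR_ge0.
  rewrite -lee_fin fineK ?bumps_H1_le//.
  rewrite ge0_fin_numE; last by rewrite adde_ge0 ?poweR_ge0.
  exact: le_lt_trans (bumps_H1_le _) (ltry _).
have -> : I = ((I `^ q^-1) `^ q)%E.
  by rewrite -poweRrM mulVf ?poweRe1// gt_eqF.
rewrite -poweR_EFin.
apply: gt0_ler_poweR; rewrite ?(ltW q0)// in_itv /= leey andbT ?poweR_ge0//.
by apply: le_trans LP; exact: poweR_ge0.
Qed.

End CuspSobolev.

(** * The Sobolev inequality fails *)

Theorem mainTheorem9 (R : realType) (n k : nat) (M : ptopologicalType)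
    (A : smooth_structure R M n) (p : 'I_k -> M) (w : tensor2 R M n)
    (mu : {measure set (borel M) -> \bar R}) (q : R) :
  (2 <= n)%N -> (1 <= k)%N ->
  compact [set: M] -> hausdorff_space M ->
  injective p ->
  poincare_like A p w ->
  volume_element A (punctured p) w mu ->
  2 < q ->
  (exists u : M -> R,
     in_H1 A (punctured p) w mu u /\ ~ in_Lp (punctured p) mu q u) /\
  ~ (exists C : R, forall (u : M -> R) (N : R),
       has_H1_norm A (punctured p) w mu u N ->
       (Lp_norm (punctured p) mu q u <= (C * N)%:E)%E).
Proof.
move=> n2 k1 _ hM _ [rw _ [g [[rg [phi [phiP disj gE]]] [C [C1 qi]]]]] vol q2.
pose i0 : 'I_k := Ordinal k1.
have [Aphi phip0 phi0 ball1] := phiP i0.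
have WP x : dom (phi i0) x -> x != p i0 -> punctured p x.
  move=> dx xp [j _ pj]; have [ji|ji] := eqVneq j i0.
    by move: xp; rewrite -pj ji eqxx.
  have [_ pjd _ _] := phiP j.
  suff : (dom (phi j) `&` dom (phi i0)) x by rewrite disj.
  by split=> //; rewrite -pj.
have w_bounds x v : dom (phi i0) x -> x != p i0 ->
    C^-1 * (cusp_scale (phi i0) x ^- 2 * sqnorm v) <= qform (w (phi i0) x) v
      <= C * (cusp_scale (phi i0) x ^- 2 * sqnorm v).
  move=> dx xp; suff <- : qform (g (phi i0) x) v =
      cusp_scale (phi i0) x ^- 2 * sqnorm v by apply: qi => //; exact: WP.
  have [_ _ rE] := height_cusp phip0 phi0 ball1 dx xp.
  rewrite gE// rE expRK opprK -exprMn sqnormE.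
  by rewrite /qform mul_mx_scalar -scalemxAl mxE.
have mW : measurable (punctured p : set (borel M)).
  apply: measurableC; apply: closed_borel.
  apply: (accessible_finite_set_closed.1 (hausdorff_accessible hM)).
  exact: finite_image.
pose b : R := 2 ^+ n.-1.
have b1 : 1 < b by rewrite exprn_egt1 ?ltr1n// -lt0n -subn1 subn_gt0.
have b0 : 0 < b by exact: lt_trans b1.
have lnb : 0 < ln b by exact: ln_gt0.
have q0 : 0 < q by exact: lt_trans q2.
(* [lam = b ^ be] with [be] the midpoint of [1/q] and [1/2], so that
   [lam ^ 2 < b < lam ^ q]. *)
pose be : R := (2^-1 + q^-1) / 2.
have qV : q^-1 < 2^-1 by rewrite ltf_pV2 ?posrE.
have be2 : be *+ 2 < 1 by rewrite /be; lra.
have beq : 1 < be * q.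
  by rewrite -ltr_pdivrMr// mul1r /be; lra.
pose lam : R := expR (be * ln b).
have lam2 : lam ^+ 2 < b.
  rewrite -[ltRHS](lnK (x := b)) ?posrE// -expRM_natl ltr_expR mulrA.
  by rewrite gtr_pMl// mulr_natl.
have lamq : b < lam `^ q.
  rewrite -[ltLHS](lnK (x := b)) ?posrE// -expRM ltr_expR mulrAC.
  by rewrite ltr_pMl.
have n0 : (0 < n)%N by exact: leq_trans n2.
split; last first.
  exact: (no_sobolev hM n0 C1 Aphi phip0 phi0 ball1 mW WP rw w_bounds vol
    (expR_gt0 _) q0 lam2 lamq).
exists (bumps_total (phi := phi i0) (lam := lam)); split.
  exact: (total_H1 hM n0 C1 Aphi phip0 phi0 ball1 mW WP rw w_bounds vol
    (expR_gt0 _) lam2).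
exact: (total_not_Lq hM n0 C1 Aphi phip0 phi0 ball1 mW WP rw w_bounds vol
  (expR_gt0 _) q0 lamq).
Qed.
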